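(* Let $y\in\mathcal Q_A\setminus\mathbb R$ and let $\mathrm S:\mathrm U_A(y,R)\to A$ be a slice regular function defined by a spherical series $\mathrm S(x)=\sum_{n\in\mathbb N}\mathscr S_{y,n}(x)s_n$ (with $s_n\in A$) centered at $y$ with positive $\mathrm u_A$-radius of convergence $R$. The following assertions hold. (i) For each $n\in\mathbb N$, define $E_n\in A$ by $$E_n:=\begin{cases}\frac1{m!}\,(2\,\mathrm{Im}(y))^m\,\frac{\partial^m\mathrm S}{\partial x^m}(y)&\text{if } n=2m,\\[2pt] \frac1{m!}\,(-2\,\mathrm{Im}(y))^m\,\frac{\partial^m\mathrm S}{\partial x^m}(y^c)&\text{if } n=2m+1.\end{cases}$$ Denote by $\mathfrak E$ and $\mathfrak s$ the infinite vectors $(E_n)_{n\in\mathbb N}$ and $\big((2\,\mathrm{Im}(y))^ns_n\big)_{n\in\mathbb N}$ in $A^{\mathbb N}$, respectively. Then $\mathfrak s$ is the unique solution of the infinite lower triangular linear system $\mathfrak e\cdot\mathfrak s=\mathfrak E$. In other words, for each $n\in\mathbb N$, it holds $$s_n=(-2\,\mathrm{Im}(y))^{-n}\det(\mathfrak e_n|\mathfrak E_n),$$ where $\mathfrak E_n$ is the column vector $(E_0,E_1,\ldots,E_n)$. In particular, the coefficients $\{s_n\}_n$ of $\mathrm S$ are uniquely determined by the derivatives $\{(\partial^n\mathrm S/\partial x^n)(y)\}_n$ and $\{(\partial^n\mathrm S/\partial x^n)(y^c)\}_n$. (ii) For each $n\in\mathbb N$, $$\frac1{n!}\,\frac{\partial^n\mathrm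 S}{\partial x^n}(y)=(2\,\mathrm{Im}(y))^{-n}\sum_{\ell=n}^{2n}e_{2n,\ell}\,(2\,\mathrm{Im}(y))^{\ell}s_\ell .$$
   Context: Algebra. $A$ is a finite-dimensional real alternative algebra with unity $1$ (so $\mathbb R\subset A$), equipped with a real linear anti-involution $x\mapsto x^c$ (so $(x^c)^c=x$, $(xy)^c=y^cx^c$). Put $t(x):=x+x^c$, $n(x):=xx^c$. The quadratic cone is $\mathcal Q_A:=\mathbb R\cup\{x\in A: t(x)\in\mathbb R,\ n(x)\in\mathbb R,\ 4n(x)>t(x)^2\}$; $\mathbb S_A:=\{J\in\mathcal Q_A: J^2=-1\}$, assumed non-empty; every $x\in\mathcal Q_A$ is of the form $\alpha+\beta J$ with $\alpha,\beta\in\mathbb R$, $J\in\mathbb S_A$. $\mathrm{Im}(x):=(x-x^c)/2$. $A$ is equipped with a norm $\|\cdot\|_A$ with $\|x\|_A=\sqrt{n(x)}$ for all $x\in\mathcal Q_A$. Slice functions. For $D\subset\mathbb C$ non-empty, open, conjugation invariant, $\Omega_D:=\{\alpha+\beta J: \alpha+i\beta\in D,\ J\in\mathbb S_A\}$. A stem function is a map $F=F_1+iF_2:D\to A\otimes_{\mathbb R}\mathbb C$ with $F_1(\bar z)=F_1(z)$, $F_2(\bar z)=-F_2(z)$; it induces the slice function $\mathcal I(F):\Omega_D\to A$, $\mathcal I(F)(\alpha+\beta J):=F_1(z)+JF_2(z)$, $z=\alpha+i\beta$. $f=\mathcal I(F)$ is slice regular if $F$ is of class $C^1$ and holomorphic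 ($\frac{\partial F}{\partial\alpha}+i\frac{\partial F}{\partial\beta}=0$). Slice derivatives: $\frac{\partial^n f}{\partial x^n}:=\mathcal I\big(\frac{\partial^nF}{\partial z^n}\big)$ with $\frac{\partial}{\partial z}=\frac12(\frac{\partial}{\partial\alpha}-i\frac{\partial}{\partial\beta})$. Spherical series. $\Delta_y(x):=x^2-x\,t(y)+n(y)$; $\mathscr S_{y,2m}(x):=\Delta_y(x)^m$, $\mathscr S_{y,2m+1}(x):=\Delta_y(x)^m(x-y)$, $m\in\mathbb N$. For $s\in A$, $\mathscr S_{y,n}(x)s$ is the value at $x$ of the slice function induced by $z\mapsto\mathscr S_{y,n}(z)s$. $\mathrm U_A(y,R):=\{x\in\mathcal Q_A:\sqrt{\|\Delta_y(x)\|_A}<R\}$. The $\mathrm u_A$-radius of convergence $R\in[0,+\infty]$ of $\sum_n\mathscr S_{y,n}(x)s_n$ is defined by $\limsup_{n}\|s_n\|_A^{1/n}=1/R$. Spherical matrix. $\mathfrak e=(e_{n\ell})_{n,\ell\in\mathbb N}$ is the infinite integer matrix with $e_{n\ell}=\binom{k}{m-k}$ if $(n,\ell)=(2m,2k)$ or $(n,\ell)=(2m+1,2k)$; $e_{n\ell}=\binom{k}{m-k-1}$ if $(n,\ell)=(2m,2k+1)$; $e_{n\ell}=-\binom{k+1}{m-k}$ if $(n,\ell)=(2m+1,2k+1)$; here $\binom ab=0$ if $b<0$ or $b>a$. It is lower triangular with $e_{nn}=(-1)^n$, and $e_{n\ell}=0$ for $\ell<\lfloor n/2\rfloor$. For $n\in\mathbb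 N$ and $E=(E_0,\dots,E_n)\in A^{n+1}$, $\mathfrak e_n$ is the $(n+1)\times n$ matrix formed by the first $n+1$ rows and first $n$ columns of $\mathfrak e$, and $(\mathfrak e_n|E)$ is the $(n+1)\times(n+1)$ matrix whose first $n$ columns are those of $\mathfrak e_n$ and whose last column is $E$; its determinant is defined in the usual way since the $e_{n\ell}$ are integers.
   Formalization: The determinant formula is proved with an extra sign: s_n = (-1)^{n(n-1)/2} (-2 Im(y))^{-n} det(e_n|E_n). As printed it fails for n = 2, 3 mod 4 when s_n ≠ 0: for y = i, S(x) = x^2+1 it gives s_2 = -1 instead of 1. *)

(* Defs.v *)
From HB Require Import structures.
From mathcomp Require Import all_boot all_order perm all_algebra.
From mathcomp Require Import all_classical all_reals all_analysis.
From mathcomp Require Import zify.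

Set Implicit Arguments.
Unset Strict Implicit.
Unset Printing Implicit Defensive.

Import Order.TTheory GRing.Theory Num.Theory.
Import numFieldNormedType.Exports.

Local Open Scope classical_set_scope.
Local Open Scope ring_scope.

(* A finite-dimensional real alternative algebra with unity and a linear
   anti-involution.  The product is not assumed associative, so none of the
   ring structures of the library applies.  The topology is that of the norm
   (all norms on a finite-dimensional space being equivalent); the algebraic
   condition on the norm is [cone_norm] below. *)
HB.mixin Record NormedModule_isAltStar (R : realType) A
    of NormedModule R A := {
  aone : A ;
  amul : A -> A -> A ;
  aconj : A -> A ;
  aone_neq0 : aone != 0 ;
  amul1a : left_id aone amul ;
  amula1 : right_id aone amul ;
  amulPl : forall (k : R) (x y z : A),
    amul (k *: x + y) z = k *: amul x z + amul y z ;
  amulPr : forall (k : R) (x y z : A),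
    amul x (k *: y + z) = k *: amul x y + amul x z ;
  amul_altl : forall x y : A, amul (amul x x) y = amul x (amul x y) ;
  amul_altr : forall x y : A, amul (amul y x) x = amul y (amul x x) ;
  aconjK : involutive aconj ;
  aconjP : forall (k : R) (x y : A), aconj (k *: x + y) = k *: aconj x + aconj y ;
  aconjM : forall x y : A, aconj (amul x y) = amul (aconj y) (aconj x) ;
  afindim : exists (n : nat) (b : 'I_n -> A),
    forall x : A, exists c : 'I_n -> R, x = \sum_(i < n) c i *: b i
}.

#[short(type="altStarAlgType")]
HB.structure Definition AltStar (R : realType) :=
  {A of NormedModule R A & NormedModule_isAltStar R A}.

Arguments aone {R s}.

Notation "x ** y" := (amul x y) (at level 40, left associativity) : ring_scope.

Section Algebra.
Context {R : realType} {A : altStarAlgType R}.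
Implicit Types (x y : A) (a : R).

Definition areal a : A := a *: aone.

Definition apow x (n : nat) : A := iter n (amul x) aone.

(* The two-sided inverse, which is unique in an alternative algebra. *)
Definition ainv x : A := xget 0 [set b | x ** b = aone /\ b ** x = aone].

Definition atrace x : A := x + aconj x.
Definition asqnorm x : A := x ** aconj x.
Definition aIm x : A := 2^-1 *: (x - aconj x).

Definition quadratic_cone : set A := [set x |
  (exists a, x = areal a) \/
  exists t n : R,
    [/\ atrace x = areal t, asqnorm x = areal n & t ^+ 2 < 4 * n]].

Definition imag_units : set A :=
  [set J | quadratic_cone J /\ J ** J = - aone].

(* On the quadratic cone, n(x) is real. *)
Definition cone_norm : Prop := forall x (r : R),
  quadratic_cone x -> asqnorm x = areal r -> `|x| = Num.sqrt r.

End Algebra.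

Arguments quadratic_cone {R} A.
Arguments imag_units {R} A.
Arguments cone_norm {R} A.

(* The complex plane is R * R, with (alpha, beta) for alpha + i beta, and the
   complexification of A is A * A, with (a, b) for a + i b; both are normed
   spaces over R, so that partial derivatives are the directional derivatives
   along (1, 0) and (0, 1). *)
Section StemFunctions.
Context {R : realType} {A : altStarAlgType R}.
Implicit Types (D : set (R * R)) (F : R * R -> A * A) (z : R * R).

Definition cconj z : R * R := (z.1, - z.2).

Definition ctens z : A * A := (areal z.1, areal z.2).
Definition atens (a : A) : A * A := (a, 0).

Definition cmul (u v : A * A) : A * A :=
  (u.1 ** v.1 - u.2 ** v.2, u.1 ** v.2 + u.2 ** v.1).
Definition cmuli (u : A * A) : A * A := (- u.2, u.1).
Definition cpow (u : A * A) (n : nat) : A * A := iter n (cmul u) (atens aone).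

Definition slice_point z (J : A) : A := areal z.1 + z.2 *: J.

Definition circular D : set A := [set x |
  exists z J, [/\ D z, imag_units A J & x = slice_point z J]].

Definition slice_domain D : Prop :=
  [/\ D !=set0, open D & forall z, D z -> D (cconj z)].

Definition stem D F : Prop := forall z, D z ->
  (F (cconj z)).1 = (F z).1 /\ (F (cconj z)).2 = - (F z).2.

(* The slice function induced by F; the value does not depend on the chosen
   decomposition of x, see [sliceE]. *)
Definition slice D F (x : A) : A := xget 0 [set a |
  exists z J, [/\ D z, imag_units A J, x = slice_point z J &
                  a = (F z).1 + J ** (F z).2]].

Definition dalpha F z : A * A := 'D_(1, 0) F z.
Definition dbeta F z : A * A := 'D_(0, 1) F z.

Definition stem_C1 D F : Prop := forall z, D z ->
  [/\ derivable F z (1, 0), derivable F z (0, 1),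
      {for z, continuous (dalpha F)} & {for z, continuous (dbeta F)}].

Definition stem_holomorphic D F : Prop := forall z, D z ->
  dalpha F z + cmuli (dbeta F z) = 0.

Definition dz F z : A * A := 2^-1 *: (dalpha F z - cmuli (dbeta F z)).

(* Functions on a subset Omega of A are total functions, of which only the
   values on Omega matter. *)
Definition slice_repr (Omega : set A) (f : A -> A) D F : Prop :=
  [/\ slice_domain D, Omega = circular D, stem D F &
      forall x, Omega x -> f x = slice D F x].

Definition slice_regular (Omega : set A) (f : A -> A) : Prop :=
  exists D F, [/\ slice_repr Omega f D F, stem_C1 D F & stem_holomorphic D F].

(* D and the restriction of F to D are determined by Omega and f, see
   [slice_derivE]. *)
Definition slice_deriv (Omega : set A) (f : A -> A) (n : nat) (x : A) : A :=
  xget 0 [set a | exists D F,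
    slice_repr Omega f D F /\ a = slice D (iter n dz F) x].

End StemFunctions.

Section SphericalSeries.
Context {R : realType} {A : altStarAlgType R}.
Implicit Types (x y : A) (s : nat -> A) (n : nat).

Definition Delta y x : A := x ** x - x ** atrace y + asqnorm y.

Definition Deltac y (z : R * R) : A * A :=
  cmul (ctens z) (ctens z) - cmul (ctens z) (atens (atrace y))
  + atens (asqnorm y).

Definition spherical_stem y n (z : R * R) : A * A :=
  let p := cpow (Deltac y z) n./2 in
  if odd n then cmul p (ctens z - atens y) else p.

Definition spherical_term y n (c x : A) : A :=
  slice setT (fun z => cmul (spherical_stem y n z) (atens c)) x.

Definition Uball y (r : \bar R) : set A :=
  [set x | quadratic_cone A x /\ ((Num.sqrt `|Delta y x|)%:E < r)%E].

Definition uradius s : \bar R :=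
  (limn_esup (fun n => (`|s n| `^ (n%:R^-1))%:E))^-1%E.

Definition spherical_sum y s (r : \bar R) (S : A -> A) : Prop :=
  [/\ (0 < r)%E, uradius s = r, slice_regular (Uball y r) S &
      forall x, Uball y r x ->
        (fun N => \sum_(0 <= n < N) spherical_term y n (s n) x) @ \oo --> S x].

End SphericalSeries.

(* Binomial coefficient with an integer lower index. *)
Definition binZ (a : nat) (b : int) : int :=
  if b is Posz k then 'C(a, k)%:Z else 0.

Definition spherical_matrix (n l : nat) : int :=
  let m := n./2 in let k := l./2 in
  if ~~ odd l then binZ k (m%:Z - k%:Z)
  else if ~~ odd n then binZ k (m%:Z - k%:Z - 1)
  else - binZ k.+1 (m%:Z - k%:Z).


Lemma spherical_matrix_lower (n l : nat) :
  (n < l)%N -> spherical_matrix n l = 0.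
Proof.
have bin_neg (a : nat) (b : int) : b < 0 -> binZ a b = 0 by case: b.
move=> nl; rewrite /spherical_matrix.
by case: ifP => [|_]; [|case: ifP] => *; rewrite bin_neg ?oppr0//; lia.
Qed.

(* Product of an infinite lower triangular integer matrix with an infinite
   vector; for [spherical_matrix], see [spherical_matrix_lower]. *)
Definition lower_mul {R : realType} {A : altStarAlgType R}
    (M : nat -> nat -> int) (u : nat -> A) (n : nat) : A :=
  \sum_(l < n.+1) u l *~ M n l.

(* Determinant, by the Leibniz formula, of the square matrix (M | E) with n
   integer columns followed by the column E of elements of A. *)
Definition det_last {R : realType} {A : altStarAlgType R} (n : nat)
    (M : 'M[int]_(n.+1, n)) (E : 'I_n.+1 -> A) : A :=
  \sum_(p : 'S_n.+1)
    E (p ord_max) *~ ((-1) ^+ p * \prod_(j < n) M (p (widen_ord (leqnSn n) j)) j).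

Definition spherical_data {R : realType} {A : altStarAlgType R} (y : A)
    (Omega : set A) (S : A -> A) (n : nat) : A :=
  let m := n./2 in
  if ~~ odd n then
    (m`!%:R : R)^-1 *: (apow (2 *: aIm y) m ** slice_deriv Omega S m y)
  else
    (m`!%:R : R)^-1 *:
      (apow (- (2 *: aIm y)) m ** slice_deriv Omega S m (aconj y)).

Lemma half_sum (R : realType) (V : lmodType R) (a b c d : V) :
  a + b = c + d -> a - b = c - d -> a = c.
Proof.
move=> e1 e2; apply: (@scalerI _ _ 2); first by rewrite pnatr_eq0.
have h u v : 2 *: u = (u + v) + (u - v) :> V.
  by rewrite addrACA subrr addr0 scaler_nat mulr2n.
by rewrite (h a b) (h c d) e1 e2.
Qed.

Section WellDefined.
Context {R : realType} {A : altStarAlgType R}.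
Implicit Types (x y J K : A) (D : set (R * R)) (F : R * R -> A * A).

Lemma amulDr x y z : x ** (y + z) = x ** y + x ** z.
Proof. by rewrite -[y]scale1r amulPr !scale1r. Qed.
Lemma amul0 x : x ** 0 = 0.
Proof. by have := amulPr (-1) x 0 0; rewrite !scaleN1r addr0 oppr0 addNr. Qed.
Lemma amulZr (k : R) x y : x ** (k *: y) = k *: (x ** y).
Proof. by have := amulPr k x y 0; rewrite amul0 !addr0. Qed.
Lemma amulNr x y : x ** (- y) = - (x ** y).
Proof. by rewrite -scaleN1r amulZr scaleN1r. Qed.
Lemma amul0l x : 0 ** x = 0.
Proof. by have := amulPl (-1) 0 0 x; rewrite !scaleN1r addr0 oppr0 addNr. Qed.
Lemma amulZl (k : R) x y : (k *: x) ** y = k *: (x ** y).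
Proof. by have := amulPl k x 0 y; rewrite amul0l !addr0. Qed.
Lemma amulNl x y : (- x) ** y = - (x ** y).
Proof. by rewrite -scaleN1r amulZl scaleN1r. Qed.

Lemma areal_inj : injective (@areal R A).
Proof.
move=> a b /eqP; rewrite -subr_eq0 -scalerBl scaler_eq0 (negPf aone_neq0).
by rewrite orbF subr_eq0 => /eqP.
Qed.

Lemma aconj1 : aconj (aone : A) = aone.
Proof.
rewrite -[LHS]amula1 -{2}[aone]aconjK -aconjM.
by rewrite amula1 aconjK.
Qed.

Lemma aconj0 : aconj (0 : A) = 0.
Proof. by have := aconjP (-1) 0 (0 : A); rewrite !scaleN1r oppr0 !add0r addNr. Qed.
Lemma aconjZ (k : R) x : aconj (k *: x) = k *: aconj x.
Proof. by have := aconjP k x 0; rewrite aconj0 !addr0. Qed.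
Lemma aconjD x y : aconj (x + y) = aconj x + aconj y.
Proof. by have := aconjP 1 x y; rewrite !scale1r. Qed.

Lemma real_not_imag (a : R) : areal a ** areal a <> - (aone : A).
Proof.
rewrite amulZr amula1 scalerA -scaleN1r => /areal_inj h.
by have := sqr_ge0 a; rewrite expr2 h oppr_ge0 ler10.
Qed.

Lemma imag_units_conj J : imag_units A J -> aconj J = - J.
Proof.
move=> [[[a ->]|[t [n [tJ nJ _]]]] JJ]; first by case: (real_not_imag JJ).
have cJ : aconj J = areal t - J by rewrite -tJ /atrace addrAC subrr add0r.
have [t0|t0] := eqVneq t 0; first by rewrite cJ t0 /areal scale0r sub0r.
move: nJ; rewrite /asqnorm cJ amulDr amulNr JJ opprK amulZr amula1 => nJ.
have h : J = areal (t^-1 * (n - 1)).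
  by rewrite /areal -scalerA scalerBl scale1r -/(areal n) -nJ addrK scalerK.
by move: JJ; rewrite h => /real_not_imag.
Qed.

Lemma slice_point_conj (z : R * R) J : imag_units A J ->
  aconj (slice_point z J) = slice_point (cconj z) J.
Proof.
move=> hJ; rewrite /slice_point/= aconjD !aconjZ aconj1 imag_units_conj//.
by rewrite scalerN scaleNr.
Qed.

Lemma slice_point_inj (z w : R * R) J K : imag_units A J -> imag_units A K ->
  slice_point z J = slice_point w K ->
  (w = z /\ (z.2 = 0 \/ K = J)) \/ (w = cconj z /\ K = - J).
Proof.
move=> hJ hK e.
have tr u L : imag_units A L ->
    slice_point u L + aconj (slice_point u L) = areal (u.1 *+ 2).
  move=> hL; rewrite slice_point_conj// /slice_point/= scaleNr addrACA subrr.
  by rewrite addr0 /areal -scalerDl.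
have e1 : z.1 = w.1.
  by apply/(pmulrnI (isT : (0 < 2)%N))/areal_inj; rewrite -(tr _ _ hJ) e tr.
move: e; rewrite /slice_point e1 => /addrI e2.
have : (z.2 *: J) ** (z.2 *: J) = (w.2 *: K) ** (w.2 *: K) by rewrite e2.
rewrite !amulZl !amulZr !scalerA hJ.2 hK.2 !scalerN => /oppr_inj/areal_inj.
rewrite -!expr2 => /eqP; rewrite eqf_sqr => /orP[] /eqP e3.
  left; split; first by case: (z) (w) e1 e3 => [? ?] [? ?] /= -> ->.
  have [|z0] := eqVneq z.2 0; [by left|right].
  by apply: (scalerI z0); rewrite e2 e3.
have [z0|z0] := eqVneq z.2 0.
  left; split; last by left.
  move/eqP: e3; rewrite z0 eq_sym oppr_eq0 => /eqP w0.
  by case: (z) (w) e1 z0 w0 => [? ?] [? ?] /= -> -> ->.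
right; split.
  by case: (z) (w) e1 e3 => [? ?] [? ?] /= -> ->; rewrite /cconj/= opprK.
by apply: (scalerI z0); rewrite scalerN e2 e3 scaleNr.
Qed.

Lemma sliceE D F (z : R * R) J : stem D F -> D z -> imag_units A J ->
  slice D F (slice_point z J) = (F z).1 + J ** (F z).2.
Proof.
move=> sF Dz hJ; rewrite /slice; case: xgetP => [a _ /=|/(_ _)/=]; last first.
  by move=> h; exfalso; apply: (h ((F z).1 + J ** (F z).2)); exists z, J.
move=> [w [K [Dw hK /(slice_point_inj hJ hK) e ->]]].
case: e => [[-> [z0|->//]]|[-> ->]].
  have := (sF _ Dz).2; have -> : cconj z = z.
    by case: (z) z0 => ? ? /= ->; rewrite /cconj/= oppr0.
  move=> /eqP; rewrite -addr_eq0 -mulr2n -scaler_nat scaler_eq0 pnatr_eq0/=.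
  by move=> /eqP ->; rewrite !amul0.
by have [-> ->] := sF _ Dz; rewrite amulNr amulNl opprK.
Qed.

Lemma circular_inj D D' : imag_units A !=set0 ->
  slice_domain D -> slice_domain D' ->
  circular D = circular D' :> set A -> D `<=` D'.
Proof.
move=> [J hJ] hD [_ _ cD'] e z Dz.
have : (circular D : set A) (slice_point z J) by exists z, J.
rewrite e => -[w [K [Dw hK /(slice_point_inj hJ hK)[[<-//]|[wz _]]]]].
by move/cD': Dw; rewrite wz; case: (z) => ? ?; rewrite /cconj/= opprK.
Qed.

Lemma slice_repr_uniq (Om : set A) f D D' F F' : imag_units A !=set0 ->
  slice_repr Om f D F -> slice_repr Om f D' F' -> D = D' /\ {in D, F =1 F'}.
Proof.
move=> S0 [hD OD sF fF] [hD' OD' sF' fF'].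
have DD' : D = D'.
  by apply/seteqP; split; apply: circular_inj => //; rewrite -OD -OD'.
split=> // z /set_mem Dz; have [J hJ] := S0; move: sF' fF'; rewrite -DD' => sF' fF'.
have E w : D w -> (F w).1 + J ** (F w).2 = (F' w).1 + J ** (F' w).2.
  move=> Dw; rewrite -(sliceE sF)// -(sliceE sF')// -fF -?fF'//;
    by rewrite OD; exists w, J.
have Dz' : D (cconj z) by case: hD => _ _; apply.
have := E _ Dz'; have := E _ Dz.
have [-> ->] := sF _ Dz; have [-> ->] := sF' _ Dz.
rewrite !amulNr => e1 e2.
have e : (F z).1 = (F' z).1 by exact: half_sum e1 e2.
move: e1; rewrite e => /addrI/(congr1 (amul J)).
rewrite -!amul_altl hJ.2 !amulNl !amul1a => /oppr_inj e'.
by move: e e'; case: (F z) (F' z) => [? ?] [? ?] /= -> ->.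
Qed.

Lemma eq_iter_dz D F F' n : open D -> {in D, F =1 F'} ->
  {in D, iter n dz F =1 iter n dz F'}.
Proof.
move=> oD FF'; elim: n => [//|n IH] z /set_mem Dz /=.
have h : \forall w \near z, iter n dz F w = iter n dz F' w.
  have := open_nbhs_nbhs (conj oD Dz); apply: filterS => w Dw.
  by apply: IH; apply/mem_set.
by rewrite /dz /dalpha /dbeta !(near_eq_derive _ h).
Qed.

Lemma slice_derivE (Om : set A) f D F n x : imag_units A !=set0 ->
  slice_repr Om f D F -> slice_deriv Om f n x = slice D (iter n dz F) x.
Proof.
move=> S0 h; rewrite /slice_deriv; case: xgetP => [a _ /=|/(_ _)/=]; last first.
  by move=> h'; exfalso; apply: (h' (slice D (iter n dz F) x)); exists D, F.
move=> [D' [F' [h' ->]]]; have [<- FF'] := slice_repr_uniq S0 h h'.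
congr xget; apply/seteqP; have [[_ oD _] _ _ _] := h.
split=> b [z [J [Dz hJ ex ->]]]; exists z, J; split => //;
  by rewrite (eq_iter_dz n oD FF' (mem_set Dz)).
Qed.

End WellDefined.

(* Main.v *)
(* Write y = a + b J, w = 2 Im(y), t = t(y), q = n(y).  Left multiplications by
   the plane R[J] turn A into a complex vector space, and the stem function of
   the series is the sum over k of Delta(z)^k (a_k + z b_k), where
   Delta(z) = z^2 - t z + q has real coefficients, a_k = s_(2k) - y s_(2k+1) and
   b_k = s_(2k+1).  Such series are stable under d/dz, by a second order estimate
   of the remainders.  At the roots y and y^c of Delta only the term k = 0
   survives, so that the m-th slice derivatives at y and y^c are a combination of
   the two first coefficients of the m-th derived series.  In terms of
   u_l = w^l s_l, derivation is an integer recursion, and Pascal's rule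
   identifies the rows of the spherical matrix with its iterates.  This matrix
   is triangular with diagonal entries 1 and -1, whence uniqueness and Cramer's
   formula. *)
Require Import Defs.
From HB Require Import structures.
From mathcomp Require Import all_boot all_order perm all_algebra.
From mathcomp Require Import all_classical all_reals all_analysis.
From mathcomp Require Import zify ring lra.
From mathcomp Require Import complex.

Import Order.TTheory GRing.Theory Num.Theory.
Import numFieldNormedType.Exports.

Local Open Scope classical_set_scope.
Local Open Scope ring_scope.

(** * Combinatorics of the spherical matrix *)

(** Why the recursion is integral: write [c] for the complex number of [y], d for its conjugate and
    w = c - d. The substitution z = c + w h turns Delta(z) = (z - c)(z - d) into w^2 h (h + 1). The
    coefficients with respect to h are then the u_l = w^l s_l, the point c becomes h = 0, its
    conjugate becomes h = -1, and d/dh = w d/dz. So E_(2m) is 1/m! times the m-th h-derivative at 0,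
    and E_(2m+1) is (-1)^m/m! times the one at -1; with first coefficients v_0, v_1 these values are
    v_0 and v_0 - v_1. A row of the matrix is thus a linear form in u, and one more derivation acts
    on it by the transpose of the recursion. Hence the binomial identities are applied to [sph_adj],
    not to iterates of [sph_deriv]. The lack of associativity shapes the rest: products are arranged
    as complex scalars acting on the left of coefficients in [A]. Differentiation is carried out in
    z, where Delta has real coefficients and the series is a stem function; the passage to h, in
    which c acts through J, is made afterwards, on coefficients only. *)

Section SphericalRows.
Context {V : zmodType}.
Implicit Types (u : nat -> V) (c : nat -> int).

(* Effect of d/dh on the coefficients of the sum over k of
   (h (h + 1))^k (u_(2k) + h u_(2k+1)). *)
Definition sph_deriv u (l : nat) : V :=
  let k := l./2 in
  if odd l then (u k.*2.+2 *+ 2 - u k.*2.+3) *+ k.+1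
  else u k.*2.+2 *+ k.+1 + u k.*2.+1 *+ k.*2.+1.

(** The transpose of [sph_deriv], acting on the coefficients of a linear form in u. For k = 0 the
    entries read at the truncated index [k.-1] are multiplied by k, hence do not count. *)
Definition sph_adj c (l : nat) : int :=
  let k := l./2 in
  if odd l then k.*2.+1%:Z * c k.*2 - k%:Z * c k.-1.*2.+1
  else k%:Z * (c k.-1.*2 + 2 * c k.-1.*2.+1).

(** Summation by parts: [key] carries a boundary term in the entries 2N and 2N+1 of u, and the
    hypothesis kills it, since it makes c vanish at 2N-2 and 2N-1. *)
Lemma sph_adjP u c N : (forall l, (N.*2 <= l.+2)%N -> c l = 0) ->
  \sum_(l < N.*2) sph_deriv u l *~ c l = \sum_(l < N.*2) u l *~ sph_adj c l.
Proof.
have key M : \sum_(l < M.*2) sph_deriv u l *~ c l =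
    \sum_(l < M.*2) u l *~ sph_adj c l
    + (u M.*2 *~ (M%:Z * (c M.-1.*2 + 2 * c M.-1.*2.+1))
       - u M.*2.+1 *~ (M%:Z * c M.-1.*2.+1)).
  elim: M => [|M IH]; first by rewrite !big_ord0 !mul0r !mulr0z subr0 addr0.
  rewrite doubleS !big_ord_recr/= {}IH -!addrA; congr +%R.
  rewrite /sph_deriv /sph_adj /= !odd_double uphalf_double doubleK /=.
  move: (c M.*2) (c M.*2.+1) (c M.-1.*2) (c M.-1.*2.+1) => c0 c1 c2 c3.
  move: (u M.*2) (u M.*2.+1) (u M.*2.+2) (u M.*2.+3) => u0 u1 u2 u3.
  have -> : u2 *~ (M.+1%:Z * (c0 + 2 * c1)) =
      u2 *+ M.+1 *~ c0 + u2 *+ 2 *+ M.+1 *~ c1.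
    rewrite !pmulrn -!mulrzA -mulrzDr; congr (_ *~ _); ring.
  have -> : u1 *~ (M.*2.+1%:Z * c0 - M%:Z * c3) =
      u1 *+ M.*2.+1 *~ c0 - u1 *~ (M%:Z * c3).
    by rewrite pmulrn -mulrzA mulrzBr.
  have -> : u3 *~ (M.+1%:Z * c1) = u3 *+ M.+1 *~ c1 by rewrite pmulrn -mulrzA.
  rewrite mulrnBl mulrzBl mulrzDl; set x := u2 *+ _ *~ c0; set w := _ - u3 *+ _ *~ _.
  rewrite /w; congr +%R; rewrite !addrA; congr +%R; congr +%R.
  by rewrite addrC addrA.
move=> c0; rewrite key !c0 ?mulr0 ?addr0 ?mulr0 ?mulr0z ?subr0 ?addr0//; lia.
Qed.

End SphericalRows.

Lemma binZ_pascal k (b : int) : binZ k.+1 b = binZ k b + binZ k (b - 1).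
Proof.
case: b => [[|b]|b].
- by rewrite /= !bin0.
- have -> : b.+1%:Z - 1 = b by lia.
  by rewrite /= binS PoszD.
- by have -> : Negz b - 1 = Negz b.+1 by lia.
Qed.

Lemma binZ_diag k (b : int) : k.+1%:Z * binZ k (b - 1) = b * binZ k.+1 b.
Proof.
case: b => [[|b]|b].
- by rewrite /= mulr0 mul0r.
- have -> : b.+1%:Z - 1 = b by lia.
  by rewrite /= -!PoszM mul_bin_diag.
- have -> : Negz b - 1 = Negz b.+1 by lia.
  by rewrite /= !mulr0.
Qed.

Lemma spherical_matrix_even_even m k :
  spherical_matrix m.*2 k.*2 = binZ k (m%:Z - k%:Z).
Proof. by rewrite /spherical_matrix !odd_double !doubleK. Qed.
Lemma spherical_matrix_even_odd m k :
  spherical_matrix m.*2 k.*2.+1 = binZ k (m%:Z - k%:Z - 1).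
Proof. by rewrite /spherical_matrix /= !odd_double /= uphalf_double doubleK. Qed.
Lemma spherical_matrix_odd_even m k :
  spherical_matrix m.*2.+1 k.*2 = binZ k (m%:Z - k%:Z).
Proof. by rewrite /spherical_matrix /= !odd_double /= uphalf_double doubleK. Qed.
Lemma spherical_matrix_odd_odd m k :
  spherical_matrix m.*2.+1 k.*2.+1 = - binZ k.+1 (m%:Z - k%:Z).
Proof. by rewrite /spherical_matrix /= !odd_double /= !uphalf_double. Qed.

Definition spherical_matrixE := (spherical_matrix_even_even,
  spherical_matrix_even_odd, spherical_matrix_odd_even, spherical_matrix_odd_odd).

Lemma binZ_mul_pascal k (b : int) :
  k.+1%:Z * binZ k b = (k.+1%:Z - b) * binZ k.+1 b.
Proof. by rewrite mulrBl -binZ_diag binZ_pascal mulrDr addrK. Qed.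

(** One more derivation leads from row 2m to row 2m+2; the factors m+1 accumulate to m!, which the
    1/m! in E compensates. *)
Lemma sph_adj_even m l : sph_adj (spherical_matrix m.*2) l =
  m.+1%:Z * spherical_matrix m.*2.+2 l.
Proof.
rewrite -(odd_double_half l) -doubleS /sph_adj; move: l./2 => k.
case: (odd l); rewrite /= ?add1n ?add0n /= ?odd_double /= ?uphalf_double ?doubleK.
  case: k => [|k]; rewrite [_.-1]/= !spherical_matrixE.
    have -> : m.+1%:Z - 0%:Z - 1 = m by lia.
    by rewrite mul0r !subr0; case: (m) => [|?]; rewrite //= !mulr0.
  have -> : m.+1%:Z - k.+1%:Z - 1 = m%:Z - k.+1%:Z by lia.
  have -> : m%:Z - k%:Z - 1 = m%:Z - k.+1%:Z by lia.
  by rewrite binZ_mul_pascal -mulrBl; congr ( *%R _ _); lia.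
case: k => [|k]; rewrite [_.-1]/= !spherical_matrixE.
  by rewrite mul0r subr0 /= mulr0.
have -> : m.+1%:Z - k.+1%:Z = m%:Z - k%:Z by lia.
rewrite mulrDr mulrCA binZ_diag binZ_mul_pascal mulrA -mulrDl.
by congr ( *%R _ _); lia.
Qed.

(** The sign reflects the factor (-w)^m in E_(2m+1), whereas each derivation in h only brings w. *)
Lemma sph_adj_odd m l : sph_adj (spherical_matrix m.*2.+1) l =
  - (m.+1%:Z * spherical_matrix m.*2.+3 l).
Proof.
rewrite -(odd_double_half l) -doubleS /sph_adj; move: l./2 => k.
case: (odd l); rewrite /= ?add1n ?add0n /= ?odd_double /= ?uphalf_double ?doubleK.
  rewrite !spherical_matrixE; case: k => [|k]; rewrite [_.-1]/=.
    rewrite mul0r !subr0; have := binZ_diag 0 m.+1%:Z.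
    have -> : m.+1%:Z - 1 = m by lia.
    by rewrite mulrN opprK.
  have -> : m.+1%:Z - k.+1%:Z = m%:Z - k%:Z by lia.
  have := congr1 ( *%R k.+1%:Z) (binZ_pascal k.+1 (m%:Z - k%:Z)).
  have := binZ_diag k.+1 (m%:Z - k%:Z).
  have -> : m%:Z - k%:Z - 1 = m%:Z - k.+1%:Z by lia.
  lia.
case: k => [|k]; rewrite [_.-1]/= !spherical_matrixE.
  by rewrite mul0r subr0 /= mulr0.
have -> : m.+1%:Z - k.+1%:Z = m%:Z - k%:Z by lia.
have := binZ_mul_pascal k (m%:Z - k%:Z); lia.
Qed.

Section IteratedSphDeriv.
Context {V : zmodType}.
Implicit Types u : nat -> V.

Lemma iter_sph_deriv_even u m N : (m < N)%N ->
  iter m sph_deriv u 0 =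
  (\sum_(l < N.*2) u l *~ spherical_matrix m.*2 l) *+ m`!.
Proof.
elim: m u N => [|m IH] u [|N]// ltmN.
  rewrite [iter _ _ _]/= fact0 mulr1n doubleS !big_ord_recl/= big1 ?addr0 ?mulr1z//.
  by move=> i _; rewrite spherical_matrix_lower.
(* The innermost derivation is split off, so that the row 2m, applied to [sph_deriv u], can be
   transposed. Its support ends at 2m, below the boundary because m + 1 <= N. *)
rewrite iterSr (IH _ N.+1) 1?ltnW// sph_adjP; last first.
  move=> l lN; apply: spherical_matrix_lower; lia.
under eq_bigr do rewrite sph_adj_even mulrC mulrzA.
by rewrite -mulrz_suml -pmulrn -mulrnA factS.
Qed.

Lemma iter_sph_deriv_odd u m N : (m < N)%N ->
  iter m sph_deriv u 0 - iter m sph_deriv u 1 =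
  (\sum_(l < N.*2) u l *~ spherical_matrix m.*2.+1 l) *~ ((-1) ^+ m * m`!%:Z).
Proof.
elim: m u N => [|m IH] u [|N]// ltmN.
  rewrite [iter _ _ _]/= fact0 mulr1z doubleS !big_ord_recl/=.
  rewrite big1 ?addr0 ?mulr1z ?mulrN1z//.
  by move=> i _; rewrite spherical_matrix_lower.
rewrite !iterSr (IH _ N.+1) 1?ltnW// sph_adjP; last first.
  move=> l lN; apply: spherical_matrix_lower; lia.
under eq_bigr do rewrite sph_adj_odd -mulNr mulrC mulrzA.
rewrite -mulrz_suml -mulrzA; congr (_ *~ _).
by rewrite factS exprS PoszM; ring.
Qed.

End IteratedSphDeriv.

(** * Triangular integer systems and Cramer's rule *)

Section TriangularSystems.
Context {R : realType} {A : altStarAlgType R}.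
Implicit Types (M : nat -> nat -> int) (u v : nat -> A).

Lemma lower_mul_inj M u v : (forall n, M n n = (-1) ^+ n) ->
  lower_mul M u = lower_mul M v -> u = v.
Proof.
move=> Mnn uv; apply/funext => n.
elim/ltn_ind: n => n IH; have := congr1 (fun f => f n) uv.
rewrite /lower_mul !big_ord_recr/= Mnn.
under eq_bigr do rewrite IH//.
move=> /addrI/(congr1 (fun x => x *~ (-1) ^+ n)).
by rewrite -!mulrzA -exprD addnn -mul2n exprM sqrrN !expr1n !mulr1z.
Qed.

Lemma det_last_lower_mul M u n : (forall i l, (i < l)%N -> M i l = 0) ->
  det_last (\matrix_(i < n.+1, j < n) M i j) (fun i => lower_mul M u i) =
  u n *~ \prod_(i < n.+1) M i i.
Proof.
move=> Mlow.
(* The transposed matrix, so that the Leibniz formula runs over columns as in [det_last]. *)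
pose B (l : nat) : 'M[int]_n.+1 :=
  \matrix_(j, i) M i (if j == ord_max then l else j).
have BE l : \det (B l) = \sum_(p : 'S_n.+1) M (p ord_max) l *
    ((-1) ^+ p * \prod_(j < n) M (p (widen_ord (leqnSn n) j)) j).
  apply: eq_bigr => p _; rewrite big_ord_recr/= mxE eqxx [RHS]mulrC -[RHS]mulrA.
  congr *%R; congr *%R.
  by apply: eq_bigr => j _; rewrite mxE -val_eqE/= ltn_eqF.
have lowE (i : 'I_n.+1) : lower_mul M u i = \sum_(l < n.+1) u l *~ M i l.
  rewrite /lower_mul -(big_mkord xpredT (fun l => u l *~ M i l)).
  rewrite -(big_mkord xpredT (fun l => u l *~ M i l)).
  rewrite (big_cat_nat (n := i.+1) (p := n.+1))//= [X in _ = _ + X]big1_seq ?addr0//.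
  by move=> l; rewrite mem_index_iota => /andP[_ /andP[? _]]; rewrite Mlow.
rewrite /det_last.
under eq_bigr do rewrite lowE mulrz_suml.
rewrite exchange_big/= big_ord_recr/= big1 ?add0r => [|l _].
  transitivity (u n *~ \det (B n)).
    rewrite BE mulrz_sumr; apply: eq_bigr => p _; rewrite mulrzA; congr (_ *~ _); congr *%R.
    by apply: eq_bigr => j _; rewrite mxE.
  rewrite -det_tr det_trig; last first.
    apply/is_trig_mxP => i j ij; rewrite !mxE; case: eqP => _; rewrite Mlow//.
    by rewrite (leq_trans ij)// leq_ord.
  by congr (_ *~ _); apply: eq_bigr => i _; rewrite !mxE; case: eqP => [->|].
transitivity (u l *~ \det (B l)).
  rewrite BE mulrz_sumr; apply: eq_bigr => p _; rewrite mulrzA; congr (_ *~ _); congr *%R.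
  by apply: eq_bigr => j _; rewrite mxE.
rewrite (determinant_alternate (i1 := widen_ord (leqnSn n) l) (i2 := ord_max)) ?mulr0z//.
  by rewrite -val_eqE/= ltn_eqF.
by move=> i; rewrite !mxE eqxx -val_eqE/= ltn_eqF.
Qed.

End TriangularSystems.

Lemma spherical_matrix_diag n : spherical_matrix n n = (-1) ^+ n.
Proof.
rewrite /spherical_matrix -signr_odd; case: (odd n); rewrite /= subrr/= bin0//.
Qed.

(** The exponent is split so that (-1)^n turns w^n into (-w)^n, leaving the sign (-1)^C(n,2) of the
    theorem. *)
Lemma prod_signs n : \prod_(i < n.+1) (-1) ^+ i = (-1) ^+ ('C(n, 2) + n) :> int.
Proof.
by rewrite prodrXr -(big_mkord xpredT id) bin2_sum binS bin1.
Qed.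

(** * Finite-dimensional normed spaces *)

Section FiniteDimension.
Context {R : realType} {V : normedModType R}.

Lemma spanning_free (n : nat) (b : 'I_n -> V) :
  (forall x, exists c : 'I_n -> R, x = \sum_(i < n) c i *: b i) ->
  exists (m : nat) (e : 'I_m -> V),
    (forall x, exists c : 'I_m -> R, x = \sum_(i < m) c i *: e i) /\
    (forall c : 'I_m -> R, \sum_(i < m) c i *: e i = 0 -> forall i, c i = 0).
Proof.
elim: n b => [|n IH] b bV; first by exists 0%N, b; split => // c _ [].
have [bfree|/existsNP[c /not_implyP[cb /existsNP[j /eqP cj]]]] := pselect
  (forall c : 'I_n.+1 -> R, \sum_(i < n.+1) c i *: b i = 0 -> forall i, c i = 0).
  by exists n.+1, b.
apply: (IH (b \o lift j)) => x; have [d ->] := bV x.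
have bj : b j = \sum_(i < n) (- (c j)^-1 * c (lift j i)) *: b (lift j i).
  apply: (scalerI cj); rewrite scaler_sumr.
  move: cb; rewrite (bigD1_ord j)//= => /eqP; rewrite addr_eq0 => /eqP ->.
  by rewrite -sumrN; apply: eq_bigr => i _; rewrite scalerA mulrA mulrN divff// mulN1r scaleNr.
exists (fun i => d j * (- (c j)^-1 * c (lift j i)) + d (lift j i)).
rewrite (bigD1_ord j)//= bj scaler_sumr -big_split/=.
by apply: eq_bigr => i _; rewrite scalerA scalerDl.
Qed.

(** The norm of the combination is continuous on the compact unit sphere of the coefficient space
    and, by freeness, positive there; C is the inverse of its minimum. *)
Lemma free_norm_bound (n : nat) (e : 'I_n -> V) :
  (forall c : 'I_n -> R, \sum_(i < n) c i *: e i = 0 -> forall i, c i = 0) ->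
  exists C : R, forall c i, `|c i| <= C * `|\sum_(i < n) c i *: e i|.
Proof.
move=> efree; case: n => [|n] in e efree *; first by exists 0 => c [].
pose f (v : 'rV[R]_n.+1) := `|\sum_(i < n.+1) v ord0 i *: e i|.
have gc : continuous (fun v : 'rV[R]_n.+1 => \sum_(i < n.+1) v ord0 i *: e i).
  apply: (@continuous_big _ _ +%R) => [|i _ v]; first exact: add_continuous.
  have vi : (u ord0 i : R) @[u --> (v : 'rV[R]_n.+1)] --> (v ord0 i : R).
    exact: coord_continuous.
  exact: cvgZr_tmp vi.
have fc : continuous f by move=> v; apply: continuous_comp (gc v) _; exact: norm_continuous.
have unit_norm (u : 'rV[R]_n.+1) : u != 0 -> `| `|u|^-1 *: u| = 1.
  by move=> u0; rewrite normrZ normfV normr_id mulVf// normr_eq0.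
have K0 : [set v : 'rV[R]_n.+1 | `|v| = 1] !=set0.
  exists (`|const_mx 1 : 'rV[R]_n.+1|^-1 *: const_mx 1); apply: unit_norm.
  by apply/eqP => /rowP/(_ ord0)/eqP; rewrite !mxE oner_eq0.
have Kc : compact [set v : 'rV[R]_n.+1 | `|v| = 1].
  apply: bounded_closed_compact.
    by exists 1; split => // M M1 v /= ->; exact: ltW.
  apply: (@preimage_closed _ _ (fun v : 'rV[R]_n.+1 => `|v|) [set 1]).
    by move=> v _; exact: norm_continuous.
  exact: closed_eq.
have [v /set_mem/= v1 fmin] := compact_EVT_min K0 Kc (continuous_subspaceT fc).
have fv : 0 < f v.
  rewrite lt_neqAle normr_ge0 andbT eq_sym normr_eq0; apply/eqP => /efree v0.
  have : v = 0 by apply/rowP => i; rewrite v0 mxE.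
  by move=> vE; move: v1; rewrite vE normr0 => /eqP; rewrite eq_sym oner_eq0.
exists (f v)^-1 => c i; rewrite mulrC ler_pdivlMr//.
pose u : 'rV[R]_n.+1 := \row_i c i.
have ciu : `|c i| <= `|u|.
  have -> : `|u| = mx_norm u by [].
  rewrite mx_normrE; have := @le_bigmax _ _ _ 0 (fun ij => `|u ij.1 ij.2|) (ord0, i).
  by rewrite /= mxE.
have [u0|u0] := eqVneq u 0.
  by move: ciu; rewrite u0 normr0 normr_le0 => /eqP ->; rewrite normr0 mul0r.
have := fmin _ (mem_set (unit_norm _ u0)).
rewrite /f; under [X in _ <= `|X|]eq_bigr do rewrite mxE -scalerA mxE.
rewrite -scaler_sumr normrZ normfV normr_id mulrC ler_pdivlMr ?normr_gt0//.
by apply: le_trans; rewrite [leRHS]mulrC ler_wpM2r.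
Qed.

Context (findimV : exists (n : nat) (b : 'I_n -> V),
  forall x, exists c : 'I_n -> R, x = \sum_(i < n) c i *: b i).

Lemma findim_coords : exists (n : nat) (e : 'I_n -> V) (k : V -> 'I_n -> R) (C : R),
  forall x, x = \sum_(i < n) k x i *: e i /\ forall i, `|k x i| <= C * `|x|.
Proof.
have [n [b /spanning_free[m [e [/choice[k ke] /free_norm_bound[C eC]]]]]] := findimV.
by exists m, e, k, C => x; split=> // i; rewrite {2}(ke x).
Qed.

Lemma findim_linear_bounded (W : normedModType R) (f : V -> W) : linear f ->
  exists2 C : R, 0 <= C & forall x, `|f x| <= C * `|x|.
Proof.
move=> flin; have [n [e [k [C kP]]]] := findim_coords.
have f0 : f 0 = 0.
  by have := flin (-1) 0 0; rewrite !scaleN1r oppr0 addr0 addNr.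
have fsum (c : 'I_n -> R) : f (\sum_(i < n) c i *: e i) = \sum_(i < n) c i *: f (e i).
  by elim/big_ind2: _ => [//|x x' y y' <- <-|i _];
    [have := flin 1 x' y'; rewrite !scale1r | have := flin (c i) (e i) 0; rewrite f0 !addr0].
exists (`|C| * \sum_(i < n) `|f (e i)|) => [|x].
  by rewrite mulr_ge0// sumr_ge0.
have [xE kC] := kP x.
rewrite {1}xE fsum (le_trans (ler_norm_sum _ _ _))// mulrAC mulr_sumr ler_sum// => i _.
by rewrite normrZ ler_wpM2r// (le_trans (kC i))// ler_wpM2r// ler_norm.
Qed.

(** The type of [V] does not include completeness; it is recovered here through the bounded
    coordinates, where absolute convergence holds in the reals. *)
Lemma findim_normed_cvg (u : V^nat) : cvgn [normed series u] -> cvgn (series u).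
Proof.
move=> cu; have [n [e [k [C kP]]]] := findim_coords.
have -> : series u = fun N => \sum_(i < n) series (fun m => k (u m) i) N *: e i.
  apply/funext => N; rewrite /series/=; under eq_bigr => j _ do rewrite {1}(kP (u j)).1.
  by rewrite exchange_big; apply: eq_bigr => i _; rewrite scaler_suml.
apply/cvg_ex; exists (\sum_(i < n) limn (series (fun m => k (u m) i)) *: e i).
apply: (cvg_big (op := +%R)) => [|i _]; first exact: add_continuous.
have ck : cvgn (series (fun m => k (u m) i)).
  apply: normed_cvg; apply: (@series_le_cvg _ _ (fun m => `|C| * `|u m|)) => [m|m|m|].
  - exact: normr_ge0.
  - by rewrite mulr_ge0.
  - by rewrite /= (le_trans ((kP _).2 i))// ler_wpM2r// ler_norm.
  - exact: is_cvg_seriesZ cu.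
exact: cvgZr_tmp ck.
Qed.

End FiniteDimension.

Local Notation re := complex.Re.
Local Notation im := complex.Im.
Local Notation cabs := (@ComplexField.Normc.normc _).

(** * The complex modulus and a Taylor remainder *)

Section ComplexModulus.
Context {R : rcfType}.
Implicit Types c d : R[i].

Lemma cabsE c : cabs c = Num.sqrt (re c ^+ 2 + im c ^+ 2).
Proof. by case: c. Qed.

Lemma cabs_ge0 c : 0 <= cabs c.
Proof. by rewrite cabsE sqrtr_ge0. Qed.

Lemma cabsM c d : cabs (c * d) = cabs c * cabs d.
Proof. exact: ComplexField.Normc.normcM. Qed.

Lemma cabsD c d : cabs (c + d) <= cabs c + cabs d.
Proof. exact: le_normcD. Qed.

Lemma cabsX c n : cabs (c ^+ n) = cabs c ^+ n.
Proof.
by elim: n => [|n IH]; rewrite ?expr0 ?ComplexField.Normc.normc1// !exprS cabsM IH.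
Qed.

Lemma cabs_re c : `|re c| <= cabs c.
Proof. by rewrite cabsE -sqrtr_sqr ler_wsqrtr// lerDl sqr_ge0. Qed.

Lemma cabs_im c : `|im c| <= cabs c.
Proof. by rewrite cabsE -sqrtr_sqr ler_wsqrtr// lerDr sqr_ge0. Qed.

Lemma cabs_real (x : R) : cabs x%:C%C = `|x|.
Proof. by rewrite cabsE /= expr0n/= addr0 sqrtr_sqr. Qed.

Lemma cabs_i : cabs ('i%C : R[i]) = 1.
Proof. by rewrite cabsE /= expr0n/= add0r expr1n sqrtr1. Qed.

Lemma realcM (x y : R) : (x * y)%:C%C = x%:C%C * y%:C%C :> R[i].
Proof. exact: (rmorphM (real_complex R)). Qed.

Lemma realcN (x : R) : (- x)%:C%C = - x%:C%C :> R[i].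
Proof. exact: (rmorphN (real_complex R)). Qed.

Lemma realc_nat n : (n%:R : R)%:C%C = n%:R :> R[i].
Proof. exact: (rmorph_nat (real_complex R)). Qed.

Lemma reD c d : re (c + d) = re c + re d. Proof. by case: c d => ? ? [? ?]. Qed.
Lemma imD c d : im (c + d) = im c + im d. Proof. by case: c d => ? ? [? ?]. Qed.
Lemma reN c : re (- c) = - re c. Proof. by case: c. Qed.
Lemma imN c : im (- c) = - im c. Proof. by case: c. Qed.
Lemma reM c d : re (c * d) = re c * re d - im c * im d.
Proof. by case: c d => ? ? [? ?]. Qed.
Lemma imM c d : im (c * d) = re c * im d + im c * re d.
Proof. by case: c d => ? ? [? ?]. Qed.

Definition reimE := (reD, imD, reN, imN, reM, imM).

(* Remainder of the first order Taylor expansion of [l x ^ k] at a point, where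
   l is affine and x quadratic, with increment h. *)
Lemma pow_taylor_bound (x y d h l0 l1 : R[i]) (rho K M : R) k :
  x = y + d * h + h ^+ 2 -> cabs x <= rho -> cabs y <= rho -> cabs h <= 1 ->
  1 <= M -> cabs d + 1 <= M * rho -> cabs l0 <= K -> cabs l1 <= K ->
  cabs ((l0 + l1 * h) * x ^+ k - l0 * y ^+ k
        - (l1 * y ^+ k + l0 * (k%:R * y ^+ k.-1 * d)) * h)
  <= K * M ^+ 2 * k.+1%:R ^+ 2 * rho ^+ k * cabs h ^+ 2.
Proof.
move=> xE xr yr h1 M1 dM l0K l1K.
have r0 : 0 <= rho by rewrite (le_trans _ xr) ?cabs_ge0.
have K0 : 0 <= K by rewrite (le_trans _ l0K) ?cabs_ge0.
have M0 : 0 <= M by rewrite (le_trans _ M1).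
have Mr0 : 0 <= M * rho by rewrite mulr_ge0.
(* The derivative at h = 0 of (l0 + l1 h) (y + d h + h^2)^j; [DS] is Leibniz' rule for one more
   factor. *)
pose D j := l1 * y ^+ j + l0 * (j%:R * y ^+ j.-1 * d).
have DS j : D j.+1 = d * (l0 * y ^+ j) + y * D j.
  rewrite /D /= exprS -[in RHS]mulrA; case: j => [|j]; first by rewrite !expr0; ring.
  by rewrite /= exprS -[j.+2]addn1 natrD; ring.
have gb j : cabs (l0 * y ^+ j) <= K * rho ^+ j.
  by rewrite cabsM cabsX ler_pM ?exprn_ge0 ?cabs_ge0// lerXn2r// nnegrE ?cabs_ge0.
have Db j : cabs (D j) <= K * M * j.+1%:R * rho ^+ j.
  elim: j => [|j IH].
    rewrite /D !mul0r mulr0 addr0 !expr0 !mulr1 (le_trans l1K)//.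
    by rewrite ler_peMr.
  rewrite DS (le_trans (cabsD _ _))// [cabs (d * _)]cabsM [cabs (y * _)]cabsM.
  have h1' : cabs d * cabs (l0 * y ^+ j) <= M * rho * (K * rho ^+ j).
    by rewrite ler_pM ?cabs_ge0// (le_trans _ dM)// lerDl ler01.
  have h2' : cabs y * cabs (D j) <= rho * (K * M * j.+1%:R * rho ^+ j).
    by rewrite ler_pM ?cabs_ge0.
  rewrite (le_trans (lerD h1' h2'))// le_eqVlt; apply/orP; left; apply/eqP.
  by rewrite exprS -[j.+2]addn1 natrD; ring.
elim: k => [|k IH].
  rewrite !expr0 /= (_ : _ - _ = 0); last by ring.
  by rewrite ComplexField.Normc.normc0 !mulr_ge0 ?exprn_ge0 ?cabs_ge0//.
rewrite -/(D _) in IH *.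
(* The remainder of order k+1 is x times that of order k, plus the second order part of (x - y)(l0
   y^k + D k h). *)
have -> : (l0 + l1 * h) * x ^+ k.+1 - l0 * y ^+ k.+1 - D k.+1 * h =
    x * ((l0 + l1 * h) * x ^+ k - l0 * y ^+ k - D k * h)
    + ((d + h) * h * (D k * h) + h ^+ 2 * (l0 * y ^+ k)).
  by rewrite DS !exprS xE; ring.
have cx : cabs (d + h) <= M * rho.
  by rewrite (le_trans (cabsD _ _))// (le_trans _ dM)// lerD2l.
have Mr1 : 1 <= M * rho by rewrite (le_trans _ dM)// lerDr cabs_ge0.
rewrite (le_trans (cabsD _ _))// cabsM.
have e1 : cabs x * cabs ((l0 + l1 * h) * x ^+ k - l0 * y ^+ k - D k * h) <=
    rho * (K * M ^+ 2 * k.+1%:R ^+ 2 * rho ^+ k * cabs h ^+ 2).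
  by rewrite ler_pM ?cabs_ge0.
have e2 : cabs ((d + h) * h * (D k * h)) <=
    M * rho * cabs h * (K * M * k.+1%:R * rho ^+ k * cabs h).
  by rewrite !cabsM !ler_pM ?mulr_ge0 ?cabs_ge0.
have e3 : cabs (h ^+ 2 * (l0 * y ^+ k)) <=
    M * rho * M * cabs h ^+ 2 * (K * rho ^+ k).
  rewrite cabsM cabsX ler_pM ?exprn_ge0 ?cabs_ge0// ler_peMl ?exprn_ge0 ?cabs_ge0//.
  by rewrite -[1]mulr1 ler_pM.
rewrite (le_trans (lerD e1 (le_trans (cabsD _ _) (lerD e2 e3))))//.
set H := cabs h; set P := rho ^+ k.
have P0 : 0 <= P by rewrite exprn_ge0.
(* The bounds e1, e2, e3 use up (k+1)^2, k+1 and 1 out of (k+2)^2; the surplus k+1 is discarded. *)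
have -> : K * M ^+ 2 * k.+2%:R ^+ 2 * rho ^+ k.+1 * H ^+ 2 =
  rho * (K * M ^+ 2 * k.+1%:R ^+ 2 * P * H ^+ 2) +
  (M * rho * H * (K * M * k.+1%:R * P * H) +
   M * rho * M * H ^+ 2 * (K * P)) + M ^+ 2 * rho * K * P * H ^+ 2 * k.+1%:R.
  by rewrite /P (exprS rho) -[k.+2]addn1 natrD; ring.
by rewrite lerDl !mulr_ge0 ?exprn_ge0 ?cabs_ge0 ?ler0n.
Qed.

End ComplexModulus.

(** * Geometric bounds on coefficients *)

Section GeometricBound.
Context {R : realType} {V : normedModType R}.
Implicit Types (a b : nat -> V) (rho : R).

Definition geom_bounded a rho := exists M : R, forall k, `|a k| * rho ^+ k <= M.

(** Morally, rho1^(k+1) - rho^(k+1) is rho1 - rho times k+1 terms that are each at least rho^k. This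
    trades a factor k+1 for a smaller radius. *)
Lemma mul_nat_exp_le rho rho1 k : 0 <= rho -> rho < rho1 ->
  k.+1%:R * rho ^+ k * (rho1 - rho) <= rho1 ^+ k.+1.
Proof.
move=> r0 rr1; have r10 : 0 <= rho1 by rewrite (le_trans r0)// ltW.
have d0 : 0 <= rho1 - rho by rewrite subr_ge0 ltW.
elim: k => [|k IH]; first by rewrite !expr0 !mul1r expr1 gerBl.
have -> : k.+2%:R * rho ^+ k.+1 * (rho1 - rho) =
    rho * (k.+1%:R * rho ^+ k * (rho1 - rho)) + rho ^+ k.+1 * (rho1 - rho).
  by rewrite exprS -[k.+2]addn1 natrD; ring.
have -> : rho1 ^+ k.+2 = rho * rho1 ^+ k.+1 + rho1 ^+ k.+1 * (rho1 - rho).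
  by rewrite [in LHS]exprS; ring.
rewrite lerD ?ler_wpM2l ?ler_wpM2r// lerXn2r// ?nnegrE//; exact: ltW.
Qed.

Lemma geom_boundedD a b rho : 0 <= rho ->
  geom_bounded a rho -> geom_bounded b rho -> geom_bounded (fun k => a k + b k) rho.
Proof.
move=> r0 [M aM] [N bN]; exists (M + N) => k.
by rewrite (le_trans _ (lerD (aM k) (bN k)))// -mulrDl ler_wpM2r ?exprn_ge0// ler_normD.
Qed.

Lemma geom_boundedZ (c : R) a rho : geom_bounded a rho ->
  geom_bounded (fun k => c *: a k) rho.
Proof.
by move=> [M aM]; exists (`|c| * M) => k; rewrite normrZ -mulrA ler_wpM2l.
Qed.

Lemma geom_bounded_le a b rho : 0 <= rho -> (forall k, `|b k| <= `|a k|) ->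
  geom_bounded a rho -> geom_bounded b rho.
Proof.
move=> r0 ba [M aM]; exists M => k.
by rewrite (le_trans _ (aM k))// ler_wpM2r// exprn_ge0.
Qed.

Lemma geom_bounded_shift a rho : 0 < rho -> geom_bounded a rho ->
  geom_bounded (a \o succn) rho.
Proof.
move=> r0 [M aM]; exists (M / rho) => k; rewrite ler_pdivlMr// -mulrA -exprSr.
exact: aM.
Qed.

Lemma geom_bounded_natmul a rho rho1 : 0 <= rho -> rho < rho1 ->
  geom_bounded a rho1 -> geom_bounded (fun k => k.+1%:R *: a k) rho.
Proof.
move=> r0 rr1 [M aM]; exists (M * rho1 / (rho1 - rho)) => k.
rewrite ler_pdivlMr ?subr_gt0// normrZ normr_nat.
have -> : k.+1%:R * `|a k| * rho ^+ k * (rho1 - rho) =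
  `|a k| * (k.+1%:R * rho ^+ k * (rho1 - rho)) by ring.
rewrite (le_trans (ler_wpM2l _ (mul_nat_exp_le _ _ k r0 rr1)))//.
by rewrite exprSr mulrA ler_wpM2r// (le_trans r0)// ltW.
Qed.

Lemma geom_bounded_series a rho rho1 : 0 <= rho -> rho < rho1 ->
  geom_bounded a rho1 -> cvgn (series (fun k => `|a k| * rho ^+ k)).
Proof.
move=> r0 rr1 [M aM]; have r10 : 0 < rho1 by rewrite (le_lt_trans r0).
apply: (@series_le_cvg _ _ (geometric M (rho / rho1))) => [k|k|k|].
- by rewrite mulr_ge0// exprn_ge0.
- have M0 : 0 <= M by rewrite (le_trans _ (aM 0))// mulr_ge0// exprn_ge0// ltW.
  by rewrite /= mulr_ge0// exprn_ge0// divr_ge0// ltW.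
- rewrite /= expr_div_n mulrA ler_pdivlMr ?exprn_gt0//.
  by rewrite mulrAC ler_wpM2r// exprn_ge0.
- apply: is_cvg_geometric_series; rewrite ger0_norm ?divr_ge0 ?(ltW r10)//.
  by rewrite ltr_pdivrMr// mul1r.
Qed.

(** Two intermediate radii: each factor k+1 costs one step, and the last gap gives convergence by
    comparison with a geometric series. *)
Lemma geom_bounded_series_sqr a rho rho1 : 0 <= rho -> rho < rho1 ->
  geom_bounded a rho1 -> cvgn (series (fun k => k.+1%:R ^+ 2 * rho ^+ k * `|a k|)).
Proof.
move=> r0 rr1 aB.
have [rho2 /andP[rr2 r21]] : exists x, rho < x < rho1.
  by exists ((rho + rho1) / 2); rewrite midf_lt//=; lra.
have [rho3 /andP[rr3 r32]] : exists x, rho < x < rho2.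
  by exists ((rho + rho2) / 2); rewrite midf_lt//=; lra.
have r20 : 0 <= rho2 by rewrite (le_trans r0)// ltW.
have r30 : 0 <= rho3 by rewrite (le_trans r0)// ltW.
have aB' := geom_bounded_natmul _ _ _ r30 r32 (geom_bounded_natmul _ _ _ r20 r21 aB).
have := geom_bounded_series _ _ _ r0 rr3 aB'.
by congr (cvgn (series _)); apply/funext => k; rewrite !normrZ normr_nat; ring.
Qed.

Lemma geom_bounded_mono a rho rho' : 0 <= rho -> rho <= rho' ->
  geom_bounded a rho' -> geom_bounded a rho.
Proof.
move=> r0 rr' [M aM]; exists M => k; rewrite (le_trans _ (aM k))// ler_wpM2l//.
by rewrite lerXn2r// nnegrE (le_trans r0).
Qed.

End GeometricBound.

(** * The complexification as a complex vector space *)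

Section ComplexifiedScaling.
Context {R : realType} {V : normedModType R}.
Implicit Types (c d : R[i]) (v : V) (u : V * V).

Definition zvec c v : V * V := (re c *: v, im c *: v).
Definition zscale c u : V * V :=
  (re c *: u.1 - im c *: u.2, re c *: u.2 + im c *: u.1).

Lemma zvecD c d v : zvec (c + d) v = zvec c v + zvec d v.
Proof. by rewrite /zvec reD imD !scalerDl. Qed.

Lemma zvecN c v : zvec (- c) v = - zvec c v.
Proof. by rewrite /zvec reN imN !scaleNr. Qed.

Lemma zvecDr c v w : zvec c (v + w) = zvec c v + zvec c w.
Proof. by rewrite /zvec !scalerDr. Qed.

Lemma zvecNr c v : zvec c (- v) = - zvec c v.
Proof. by rewrite /zvec !scalerN. Qed.

Lemma zvecZr c (x : R) v : zvec c (x *: v) = zvec (c * x%:C%C) v.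
Proof. by rewrite /zvec reM imM /= !mulr0 subr0 add0r !scalerA. Qed.

Lemma zscaleM c d v : zscale c (zvec d v) = zvec (c * d) v.
Proof.
by rewrite /zscale /zvec reM imM /= !scalerA scalerBl scalerDl.
Qed.

Lemma zscaleD c u u' : zscale c (u + u') = zscale c u + zscale c u'.
Proof.
by rewrite /zscale /= !scalerDr opprD; congr (_, _); rewrite addrACA.
Qed.

Lemma zscale0 c : zscale c (0 : V * V) = 0.
Proof. by rewrite /zscale /= !scaler0 subr0 addr0. Qed.

Lemma zscale_real (x : R) u : zscale x%:C%C u = x *: u.
Proof. by rewrite /zscale /= !scale0r subr0 addr0; case: u. Qed.

Lemma norm_zvec c v : `|zvec c v| <= cabs c * `|v|.
Proof.
by rewrite prod_normE /zvec /= !normrZ ge_max !ler_wpM2r// ?cabs_re ?cabs_im.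
Qed.

Lemma pair_cvg_unique (f : nat -> V * V) (u v : V * V) :
  f @ \oo --> u -> f @ \oo --> v -> u = v.
Proof. by move=> fu fv; apply: (cvg_unique _ fu fv); exact: norm_hausdorff. Qed.

Lemma cvg_fst_snd (f : nat -> V * V) (u : V * V) : f @ \oo --> u ->
  (fun n => (f n).1) @ \oo --> u.1 /\ (fun n => (f n).2) @ \oo --> u.2.
Proof.
move=> fu; split; apply: (cvg_comp _ _ fu); case: (u) => ? ?.
  exact: cvg_fst.
exact: cvg_snd.
Qed.

Lemma cvg_zscale c (f : nat -> V * V) u : f @ \oo --> u ->
  (fun n => zscale c (f n)) @ \oo --> zscale c u.
Proof.
move=> /cvg_fst_snd[f1 f2]; apply: cvg_pair; first by apply: cvgB; exact: cvgZl_tmp.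
by apply: cvgD; exact: cvgZl_tmp.
Qed.

End ComplexifiedScaling.

(** * Series in powers of a quadratic polynomial *)

(* The partial sums of the stem function of a spherical series have the form
   sum_k Delta(z)^k (a_k + z b_k), with Delta(z) = z^2 - t z + q real; these
   series are stable under d/dz. *)
Section QuadraticSeries.
Context {R : realType} {V : normedModType R}.
Context (absV : forall u : nat -> V, cvgn [normed series u] -> cvgn (series u)).
Context (t q : R).
Implicit Types (a b : nat -> V) (z h : R[i]) (rho : R).

Definition quad z : R[i] := z ^+ 2 - t%:C%C * z + q%:C%C.

Definition quad_term (ab : (nat -> V) * (nat -> V)) z k : V * V :=
  zvec (quad z ^+ k) (ab.1 k) + zvec (z * quad z ^+ k) (ab.2 k).

Definition quad_series ab z : V * V :=
  (limn (series (fun k => (quad_term ab z k).1)),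
   limn (series (fun k => (quad_term ab z k).2))).

(** Obtained from (2z - t)(a + z b) + Delta b-type terms by reducing z^2 to Delta + t z - q: one has
    (2z - t)(a + z b) = (- t a - 2 q b) + z (2 a + t b) + 2 Delta b. The last term, times k, joins
    the derivative of z b to give the factor 2k+1. *)
Definition quad_deriv (ab : (nat -> V) * (nat -> V)) :
    (nat -> V) * (nat -> V) :=
  (fun k => k.+1%:R *: (- t *: ab.1 k.+1 - (2 * q) *: ab.2 k.+1)
            + k.*2.+1%:R *: ab.2 k,
   fun k => k.+1%:R *: (2 *: ab.1 k.+1 + t *: ab.2 k.+1)).

Definition quad_bounded (ab : (nat -> V) * (nat -> V)) rho :=
  geom_bounded ab.1 rho /\ geom_bounded ab.2 rho.

Lemma quad_bounded_deriv ab rho rho1 : 0 <= rho -> rho < rho1 ->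
  quad_bounded ab rho1 -> quad_bounded (quad_deriv ab) rho.
Proof.
move=> r0 rr1 [aB bB]; have r10 := le_lt_trans r0 rr1.
have h (x y : R) (c d : nat -> V) : geom_bounded c rho1 -> geom_bounded d rho1 ->
    geom_bounded (fun k => k.+1%:R *: (x *: c k + y *: d k)) rho.
  move=> cB dB; apply: (@geom_bounded_natmul _ _ (fun k => x *: c k + y *: d k) _ rho1) => //.
  by apply: geom_boundedD; [exact: ltW|exact: geom_boundedZ..].
have aB' := geom_bounded_shift _ _ r10 aB; have bB' := geom_bounded_shift _ _ r10 bB.
split; last exact: h.
apply: (geom_boundedD (fun k => k.+1%:R *: _)) => //.
  rewrite (_ : (fun k => _) = fun k => k.+1%:R *: (- t *: (ab.1 \o succn) k
      + - (2 * q) *: (ab.2 \o succn) k)); first exact: h.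
  by apply/funext => k; rewrite /= [- (2 * q) *: _]scaleNr.
apply: (@geom_bounded_le _ _ (fun k => k.+1%:R *: (2 *: ab.2 k + 0 *: ab.2 k))) => // [k|].
  rewrite scale0r addr0 !normrZ !normr_nat mulrA -natrM ler_wpM2r// ler_nat; lia.
exact: h.
Qed.

Lemma norm_quad_term ab z rho k : cabs (quad z) <= rho ->
  `|quad_term ab z k| <= rho ^+ k * (`|ab.1 k| + cabs z * `|ab.2 k|).
Proof.
move=> zr; have qk : cabs (quad z ^+ k) <= rho ^+ k.
  by rewrite cabsX lerXn2r// ?nnegrE ?cabs_ge0// (le_trans _ zr)// cabs_ge0.
rewrite (le_trans (ler_normD _ _))// mulrDr lerD//.
  by rewrite (le_trans (norm_zvec _ _))// ler_wpM2r.
rewrite (le_trans (norm_zvec _ _))// cabsM [cabs z * _]mulrC -mulrA ler_wpM2r//.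
by rewrite mulr_ge0// cabs_ge0.
Qed.

Lemma cvg_pair_series (u : nat -> V * V) (v : nat -> R) :
  (forall k, `|u k| <= v k) -> cvgn (series v) ->
  series u @ \oo -->
    (limn (series (fun k => (u k).1)), limn (series (fun k => (u k).2))).
Proof.
move=> uv cv.
have c1 : cvgn (series (fun k => (u k).1)).
  apply: absV; apply: series_le_cvg cv => k; rewrite ?normr_ge0//.
    exact: le_trans (uv k).
  by rewrite (le_trans _ (uv k))// prod_normE le_max lexx.
have c2 : cvgn (series (fun k => (u k).2)).
  apply: absV; apply: series_le_cvg cv => k; rewrite ?normr_ge0//.
    exact: le_trans (uv k).
  by rewrite (le_trans _ (uv k))// prod_normE le_max lexx orbT.
have -> : series u = fun n => (series (fun k => (u k).1) n, series (fun k => (u k).2) n).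
  apply/funext => n; rewrite /series /=; elim/big_rec3: _ => [//|k x y z _ ->].
  by case: (u k).
exact: (cvg_pair c1 c2).
Qed.

Lemma quad_series_cvg ab z rho : cabs (quad z) < rho -> quad_bounded ab rho ->
  series (quad_term ab z) @ \oo --> quad_series ab z.
Proof.
move=> zr [aB bB]; have q0 := cabs_ge0 (quad z).
pose v k := `|ab.1 k| * cabs (quad z) ^+ k + cabs z * (`|ab.2 k| * cabs (quad z) ^+ k).
apply: (@cvg_pair_series _ v) => [k|].
  by rewrite (le_trans (norm_quad_term _ _ _ _ (lexx _)))// le_eqVlt; apply/orP; left;
    apply/eqP; rewrite /v; ring.
have -> : v = (fun k => `|ab.1 k| * cabs (quad z) ^+ k) +
  cabs z *: (fun k => `|ab.2 k| * cabs (quad z) ^+ k) by [].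
apply: is_cvg_seriesD; last apply: is_cvg_seriesZ; exact: geom_bounded_series q0 zr _.
Qed.

(** The h-derivative at 0 of (l0 + l1 h) (y + d h + h^2)^k. The pairs (1, 0) and (z, 1) for (l0, l1)
    give the terms with a_k and z b_k. *)
Definition affine_pow_deriv (l0 l1 y d : R[i]) k : R[i] :=
  l1 * y ^+ k + l0 * (k%:R * y ^+ k.-1 * d).

(** Derivation shifts indices, so differentiating N+1 terms gives N complete terms of the derived
    series and the leftover in Delta^N. *)
Lemma quad_deriv_sum (ab : (nat -> V) * (nat -> V)) z N (d := 2 * z - t%:C%C) :
  \sum_(k < N.+1) (zvec (affine_pow_deriv 1 0 (quad z) d k) (ab.1 k) +
                   zvec (affine_pow_deriv z 1 (quad z) d k) (ab.2 k)) =
  series (quad_term (quad_deriv ab) z) N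
  + zvec (quad z ^+ N) (N.*2.+1%:R *: ab.2 N).
Proof.
elim: N => [|N IH].
  rewrite big_ord1 /series /= big_geq// add0r /affine_pow_deriv.
  rewrite !mul0r !mulr0 !addr0 !expr0 mulr1 zvecZr mulr1.
  by rewrite {1}/zvec /= !scale0r (_ : (0, 0) = 0)// add0r.
rewrite big_ord_recr/= {}IH seriesSr -!addrA; congr +%R.
rewrite /= zvecDr -!addrA [RHS]addrCA; congr +%R.
rewrite scalerBr scalerDr !scalerA !zvecDr zvecNr -zvecN !zvecZr.
rewrite -!addrA [X in _ = _ + X]addrCA !addrA -zvecD -!addrA -!zvecD.
set p := quad z ^+ N.
have pS : quad z ^+ N.+1 = p * quad z by rewrite exprSr.
rewrite /affine_pow_deriv /= pS !realcM !realcN !realc_nat -/p.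
congr (zvec _ _ + zvec _ _).
  rewrite /d; ring.
rewrite -[N.+1.*2.+1]addn1 natrD -muln2 natrM /quad /d; ring.
Qed.

End QuadraticSeries.

Lemma doubleS_le_sqr n : (n.*2.+1 <= 2 * n.+1 ^ 2)%N.
Proof. by rewrite -mulnn mulSn mulnS; lia. Qed.

Lemma subrACA (W : zmodType) (a b c x y w : W) :
  (a + x) - (b + y) - (c + w) = (a - b - c) + (x - y - w).
Proof. by rewrite !opprD (addrACA a) (addrACA (a - b)). Qed.

Section QuadraticSeriesDerivative.
Context {R : realType} {V : normedModType R}.
Context (absV : forall u : nat -> V, cvgn [normed series u] -> cvgn (series u)).
Context (t q : R).
Implicit Types (ab : (nat -> V) * (nat -> V)) (z h : R[i]) (rho : R).

(** The remainder of every partial sum is bounded by the same multiple of |h|^2, and the bound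
    passes to the limit. *)
Lemma quad_series_taylor ab z rho rho1 :
  cabs (quad t q z) < rho -> rho < rho1 -> quad_bounded ab rho1 ->
  exists C delta : R, 0 < delta /\ forall h, cabs h <= delta ->
    `|quad_series t q ab (z + h) - quad_series t q ab z
      - zscale h (quad_series t q (quad_deriv t q ab) z)| <= C * cabs h ^+ 2.
Proof.
move=> zr rr1 abB; have [aB bB] := abB.
have r0 : 0 < rho by rewrite (le_lt_trans _ zr)// cabs_ge0.
pose d := 2 * z - t%:C%C.
pose L := cabs d + 1.
have L0 : 0 < L by rewrite ltr_wpDl ?cabs_ge0.
pose M := Num.max 1 (L / rho).
have M1 : 1 <= M by rewrite le_max lexx.
have LM : L <= M * rho by rewrite -ler_pdivrMr// le_max lexx orbT.
pose K := 1 + cabs z.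
have zK : cabs z <= K by rewrite lerDr.
have K1 : 1 <= K by rewrite lerDl cabs_ge0.
(* The squared factor comes from the remainder of a k-th power; the series converges because
   [rho < rho1]. *)
pose B k := k.+1%:R ^+ 2 * rho ^+ k * (`|ab.1 k| + `|ab.2 k|).
have B0 k : 0 <= B k by rewrite !mulr_ge0 ?exprn_ge0 ?addr_ge0 ?(ltW r0).
have cB : cvgn (series B).
  have -> : B = (fun k => k.+1%:R ^+ 2 * rho ^+ k * `|ab.1 k|) +
                (fun k => k.+1%:R ^+ 2 * rho ^+ k * `|ab.2 k|).
    by apply/funext => k; rewrite /B mulrDr.
  by apply: is_cvg_seriesD; apply: (geom_bounded_series_sqr _ _ _ (ltW r0) rr1).
pose C := K * M ^+ 2 * limn (series B).
(* For |h| <= 1 the increment d h + h^2 of Delta is at most L |h|, so this choice keeps Delta(z + h)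
   within [rho]. *)
pose delta := Num.min 1 ((rho - cabs (quad t q z)) / L).
exists C, delta; split; first by rewrite lt_min ltr01 divr_gt0// subr_gt0.
move=> h; rewrite le_min => /andP[h1 hL].
have xE : quad t q (z + h) = quad t q z + d * h + h ^+ 2 by rewrite /quad /d; ring.
have xr : cabs (quad t q (z + h)) <= rho.
  rewrite xE -addrA (le_trans (cabsD _ _))// -lerBrDl.
  move: hL; rewrite ler_pdivlMr// => /(le_trans _); apply.
  rewrite (le_trans (cabsD _ _))// cabsM cabsX /L mulrDr mulr1 [cabs d * _]mulrC.
  by rewrite lerD2l expr2 ler_piMl// cabs_ge0.
have zr' := ltW zr.
have r1K : cabs (1 : R[i]) <= K by rewrite ComplexField.Normc.normc1.
have r0K : cabs (0 : R[i]) <= K by rewrite ComplexField.Normc.normc0 (le_trans _ K1).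
pose T N := series (quad_term t q ab (z + h)) N - series (quad_term t q ab z) N
  - zscale h (\sum_(k < N) (zvec (affine_pow_deriv 1 0 (quad t q z) d k) (ab.1 k) +
                   zvec (affine_pow_deriv z 1 (quad t q z) d k) (ab.2 k))).
pose r l0 l1 k := (l0 + l1 * h) * quad t q (z + h) ^+ k - l0 * quad t q z ^+ k
  - affine_pow_deriv l0 l1 (quad t q z) d k * h.
have TE N : T N = \sum_(k < N) (zvec (r 1 0 k) (ab.1 k) + zvec (r z 1 k) (ab.2 k)).
  elim: N => [|N IH].
    rewrite /T /series /= !big_geq// !big_ord0.
    by rewrite zscale0 !subr0.
  have step : quad_term t q ab (z + h) N - quad_term t q ab z N
      - zscale h (zvec (affine_pow_deriv 1 0 (quad t q z) d N) (ab.1 N)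
                  + zvec (affine_pow_deriv z 1 (quad t q z) d N) (ab.2 N)) =
      zvec (r 1 0 N) (ab.1 N) + zvec (r z 1 N) (ab.2 N).
    rewrite zscaleD !zscaleM /quad_term subrACA -!zvecN -!zvecD.
    by congr (zvec _ _ + zvec _ _); rewrite /r; ring.
  rewrite [RHS]big_ord_recr/= -IH -step /T !seriesSr big_ord_recr/=.
  rewrite [in LHS]zscaleD.
  exact: subrACA.
have rB l0 l1 k : cabs l0 <= K -> cabs l1 <= K ->
    cabs (r l0 l1 k) <= K * M ^+ 2 * k.+1%:R ^+ 2 * rho ^+ k * cabs h ^+ 2.
  by move=> l0K l1K; apply: pow_taylor_bound xE _ _ _ _ _ _ _.
have TB N : `|T N| <= C * cabs h ^+ 2.
  rewrite TE (le_trans (ler_norm_sum _ _ _))//.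
  apply: (@le_trans _ _ (K * M ^+ 2 * cabs h ^+ 2 * series B N)).
    rewrite /series /= big_mkord mulr_sumr ler_sum// => k _.
    have -> : K * M ^+ 2 * cabs h ^+ 2 * B k =
       K * M ^+ 2 * k.+1%:R ^+ 2 * rho ^+ k * cabs h ^+ 2 * `|ab.1 k| +
       K * M ^+ 2 * k.+1%:R ^+ 2 * rho ^+ k * cabs h ^+ 2 * `|ab.2 k| by rewrite /B; ring.
    rewrite (le_trans (ler_normD _ _))// lerD// (le_trans (norm_zvec _ _))//.
      by rewrite ler_wpM2r// rB.
    by rewrite ler_wpM2r// rB.
  rewrite /C [leRHS]mulrAC ler_wpM2l//.
    by rewrite mulr_ge0 ?sqr_ge0// mulr_ge0 ?sqr_ge0// (le_trans _ K1).
  apply: (nondecreasing_cvgn_le _ cB); apply: nondecreasing_series.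
  by move=> *; exact: B0.
have c1 : series (quad_term t q ab (z + h)) N.+1 @[N --> \oo] --> quad_series t q ab (z + h).
  apply: (cvg_comp _ _ (cvg_addnl 1)).
  exact: (quad_series_cvg absV _ _ _ _ _ (le_lt_trans xr rr1)).
have c2 : series (quad_term t q ab z) N.+1 @[N --> \oo] --> quad_series t q ab z.
  apply: (cvg_comp _ _ (cvg_addnl 1)).
  exact: (quad_series_cvg absV _ _ _ _ _ (lt_trans zr rr1)).
have c3 : series (quad_term t q (quad_deriv t q ab) z) @ \oo -->
    quad_series t q (quad_deriv t q ab) z.
  apply: (quad_series_cvg absV _ _ _ _ _ zr).
  exact: quad_bounded_deriv (ltW r0) rr1 abB.
(* The leftover term of [quad_deriv_sum] is at most |h| 2 B N, which tends to 0 as the general term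
   of a convergent series. *)
have c4 : (fun N => C * cabs h ^+ 2 + cabs h * 2 * B N) @ \oo -->
    C * cabs h ^+ 2 + cabs h * 2 * 0.
  apply: cvgD; first exact: cvg_cst.
  by apply: cvgM; [exact: cvg_cst | exact: cvg_series_cvg_0].
rewrite mulr0 addr0 in c4.
apply: (ler_cvg_to (cvg_norm (cvgB (cvgB c1 c2) (cvg_zscale h _ _ c3))) c4).
apply: nearW => N; have := TB N.+1.
rewrite /T quad_deriv_sum zscaleD zscaleM opprD addrA.
set X := _ - zscale h _ => TBN.
change (`|X| <= C * cabs h ^+ 2 + cabs h * 2 * B N).
rewrite -(subrK (zvec (h * quad t q z ^+ N) (N.*2.+1%:R *: ab.2 N)) X).
rewrite (le_trans (ler_normD _ _))// lerD// (le_trans (norm_zvec _ _))//.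
rewrite cabsM cabsX normrZ normr_nat -!mulrA ler_wpM2l ?cabs_ge0//.
have -> : 2 * B N = rho ^+ N * ((2 * N.+1 ^ 2)%:R * (`|ab.1 N| + `|ab.2 N|)).
  by rewrite /B natrM natrX; ring.
rewrite !ler_pM ?mulr_ge0 ?exprn_ge0 ?cabs_ge0 ?lerDr//.
  by rewrite lerXn2r// ?nnegrE ?cabs_ge0// ltW.
by rewrite ler_nat doubleS_le_sqr.
Qed.

End QuadraticSeriesDerivative.

Lemma derive_taylor (R : realType) (U W : normedModType R) (F : U -> W) (z v : U) (L : W)
    (C delta : R) : 0 < delta ->
  (forall x : R, `|x| <= delta -> `|F (x *: v + z) - F z - x *: L| <= C * `|x| ^+ 2) ->
  'D_v F z = L.
Proof.
move=> d0 FL; apply: cvg_lim; first exact: norm_hausdorff.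
apply/cvgrPdist_le => e e0; near=> x.
have x0 : x != 0 by near: x; exact: nbhs_dnbhs_neq.
have xd : `|x| <= delta by near: x; apply: dnbhs0_le.
have xe : `|x| <= e / (`|C| + 1) by near: x; apply: dnbhs0_le; rewrite divr_gt0// ltr_wpDl.
have -> : L - x^-1 *: ((F \o shift z) (x *: v) - F z) =
    - x^-1 *: (F (x *: v + z) - F z - x *: L).
  by rewrite /= scaleNr [in RHS]scalerBr scalerK// opprB.
rewrite normrZ normrN normfV mulrC ler_pdivrMr ?normr_gt0//.
rewrite (le_trans (FL x xd))// expr2 mulrA ler_wpM2r//.
rewrite (le_trans (ler_wpM2r _ (ler_norm C)))//.
rewrite (le_trans _ (_ : (`|C| + 1) * (e / (`|C| + 1)) <= _))//.
  by rewrite ler_pM// lerDl.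
by rewrite mulrC divfK// gt_eqF// ltr_wpDl.
Unshelve. all: by end_near. Qed.

Section StemOfQuadraticSeries.
Context {R : realType} {A : altStarAlgType R}.
Context (absA : forall u : nat -> A, cvgn [normed series u] -> cvgn (series u)).
Context (t q : R).
Implicit Types (ab : (nat -> A) * (nat -> A)) (z : R * R) (rho : R).

Definition cplx z : R[i] := (z.1 +i* z.2)%C.

Lemma cplx_shift_re z (x : R) : cplx (x *: (1, 0) + z) = cplx z + x%:C%C.
Proof.
apply/eqP; rewrite eq_complex reD imD /= addr0 [x *: 1]mulr1 [x *: 0]mulr0 add0r.
by rewrite addrC !eqxx.
Qed.

Lemma cplx_shift_im z (x : R) : cplx (x *: (0, 1) + z) = cplx z + x%:C%C * 'i%C.
Proof.
apply/eqP; rewrite eq_complex reD imD reM imM /= !mulr0 !mul0r subr0 !addr0 mulr1.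
by rewrite [x *: 1]mulr1 [x *: 0]mulr0 add0r addrC !eqxx.
Qed.

Definition quad_stem ab z : A * A := quad_series t q ab (cplx z).

(** The complex estimate, taken with h = x and with h = x i, shows that the two partial derivatives
    are G and i G, so their combination in [dz] is G. *)
Lemma dz_quad_stem ab z rho rho1 :
  cabs (quad t q (cplx z)) < rho -> rho < rho1 -> quad_bounded ab rho1 ->
  dz (quad_stem ab) z = quad_stem (quad_deriv t q ab) z.
Proof.
move=> zr rr1 abB.
have [C [delta [d0 taylor]]] := quad_series_taylor absA _ _ _ _ _ _ zr rr1 abB.
set G := quad_stem (quad_deriv t q ab) z.
have da : dalpha (quad_stem ab) z = G.
  apply: (derive_taylor _ _ _ _ _ _ _ C delta d0) => x xd.
  rewrite /quad_stem cplx_shift_re.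
  by rewrite -zscale_real -(cabs_real x); apply: taylor; rewrite cabs_real.
have db : dbeta (quad_stem ab) z = cmuli G.
  apply: (derive_taylor _ _ _ _ _ _ _ C delta d0) => x xd.
  rewrite /quad_stem cplx_shift_im.
  have xi : cabs (x%:C%C * 'i%C) = `|x| by rewrite cabsM cabs_real cabs_i mulr1.
  have -> : x *: cmuli G = zscale (x%:C%C * 'i%C) G.
    rewrite /zscale reM imM /= !mulr0 !mul0r subr0 !scale0r addr0 mulr1 sub0r add0r.
    by rewrite /cmuli -scalerN.
  by rewrite -xi; apply: taylor; rewrite xi.
rewrite /dz da db.
have -> : cmuli (cmuli G) = - G by [].
rewrite opprK scalerDr -scalerDl (_ : 2^-1 + 2^-1 = 1) ?scale1r//; lra.
Qed.

End StemOfQuadraticSeries.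

(** * The complex planes R[J] *)

Section SlicePlane.
Context {R : realType} {A : altStarAlgType R}.
Implicit Types (x y J : A) (c d : R[i]) (a b : R).

Lemma amulDl x y z : (x + y) ** z = x ** z + y ** z.
Proof. by rewrite -[x in LHS]scale1r amulPl scale1r. Qed.

Lemma amulBr x y z : x ** (y - z) = x ** y - x ** z.
Proof. by rewrite amulDr amulNr. Qed.

Lemma areal_amul a x : areal a ** x = a *: x.
Proof. by rewrite amulZl amul1a. Qed.

Lemma amul_areal a x : x ** areal a = a *: x.
Proof. by rewrite amulZr amula1. Qed.

(* The point a + b J of the complex plane R[J], for the complex number a + b i;
   [slice_point z J] is [plane_point J (cplx z)]. *)
Definition plane_point J c : A := slice_point (re c, im c) J.

Lemma plane_point_amul J c x : plane_point J c ** x = re c *: x + im c *: (J ** x).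
Proof. by rewrite amulDl areal_amul amulZl. Qed.

Lemma plane_pointD J c d : plane_point J (c + d) = plane_point J c + plane_point J d.
Proof. by rewrite /plane_point/slice_point/areal/= reD imD !scalerDl addrACA. Qed.

Lemma plane_pointN J c : plane_point J (- c) = - plane_point J c.
Proof. by rewrite /plane_point/slice_point/areal/= reN imN !scaleNr opprD. Qed.

Lemma plane_point_real J a : plane_point J a%:C%C = areal a.
Proof. by rewrite /plane_point/slice_point/= scale0r addr0. Qed.

Lemma slice_pointE z J : slice_point z J = plane_point J (cplx z).
Proof. by []. Qed.

Context (J : A) (hJ : imag_units A J).

(** Left alternativity replaces associativity here; [plane_point_amulA] extends this to all of
    R[J]. *)
Lemma imag_unit_amulK x : J ** (J ** x) = - x.
Proof. by rewrite -amul_altl hJ.2 amulNl amul1a. Qed.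

(* Left multiplications by elements of R[J] make A a complex vector space. *)
Lemma plane_point_amulA c d x :
  plane_point J c ** (plane_point J d ** x) = plane_point J (c * d) ** x.
Proof.
rewrite !plane_point_amul amulDr !amulZr imag_unit_amulK reM imM !scalerDr !scalerA.
by rewrite scalerN scalerBl scalerDl [X in _ + X]addrC addrACA.
Qed.

Lemma plane_pointM c d : plane_point J c ** plane_point J d = plane_point J (c * d).
Proof. by rewrite -[plane_point J d]amula1 plane_point_amulA amula1. Qed.

Lemma apow_plane_point c n : apow (plane_point J c) n = plane_point J (c ^+ n).
Proof.
elim: n => [|n IH]; first by rewrite expr0 (plane_point_real J 1) /areal scale1r.
by rewrite /apow iterS -/(apow _ n) IH plane_pointM exprS.
Qed.

Lemma plane_pointVK c x : c != 0 ->
  plane_point J c^-1 ** (plane_point J c ** x) = x.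
Proof.
move=> c0; rewrite plane_point_amulA mulVf// (plane_point_real J 1) areal_amul.
exact: scale1r.
Qed.

(** Whichever two-sided inverse [xget] selects, left cancellation by the plane identifies it. *)
Lemma ainv_plane_point c : c != 0 -> ainv (plane_point J c) = plane_point J c^-1.
Proof.
move=> c0; have J1 : plane_point J 1 = aone.
  by rewrite (plane_point_real J 1) /areal scale1r.
rewrite /ainv; case: xgetP => [b _ /= [cb _]|/(_ (plane_point J c^-1))[]].
  by rewrite -[LHS](plane_pointVK c b c0) cb amula1.
by split; rewrite plane_pointM ?mulfV ?mulVf.
Qed.

Lemma aconj_plane_point c : aconj (plane_point J c) = plane_point J c^*%C.
Proof. by rewrite /plane_point slice_point_conj//; case: c. Qed.

Lemma atrace_plane_point c : atrace (plane_point J c) = areal (2 * re c).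
Proof.
rewrite /atrace aconj_plane_point -plane_pointD -(plane_point_real J); congr plane_point.
by case: c => a b; apply/eqP; rewrite eq_complex reD imD /= subrr mulr2n mulrDl mul1r !eqxx.
Qed.

Lemma asqnorm_plane_point c :
  asqnorm (plane_point J c) = areal (re c ^+ 2 + im c ^+ 2).
Proof.
rewrite /asqnorm aconj_plane_point plane_pointM -(plane_point_real J).
congr plane_point; case: c => a b; apply/eqP; rewrite eq_complex reM imM /=.
by apply/andP; split; apply/eqP; ring.
Qed.

Lemma plane_point_cone c : quadratic_cone A (plane_point J c).
Proof.
have [c0|c0] := eqVneq (im c) 0.
  by left; exists (re c); rewrite /plane_point /slice_point /= c0 scale0r addr0.
right; exists (2 * re c), (re c ^+ 2 + im c ^+ 2).
rewrite atrace_plane_point asqnorm_plane_point; split => //.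
by rewrite exprMn mulrDr -natrX ltrDl mulr_gt0// exprn_even_gt0.
Qed.

Lemma norm_plane_point c : cone_norm A -> `|plane_point J c| = cabs c.
Proof.
by move=> hN; rewrite (hN _ _ (plane_point_cone c) (asqnorm_plane_point c)) cabsE.
Qed.

End SlicePlane.

(** Completing the square in x^2 = t x - n: x - t/2 has square - b^2 with b^2 = n - t^2/4 > 0, so
    dividing by b gives an imaginary unit. *)
Lemma quadratic_coneP (R : realType) (A : altStarAlgType R) (x : A) :
  imag_units A !=set0 -> quadratic_cone A x ->
  exists J c, imag_units A J /\ x = plane_point J c.
Proof.
move=> [J hJ] [[a ->]|[t [n [tx nx tn]]]].
  by exists J, a%:C%C; rewrite plane_point_real.
pose b := Num.sqrt (n - t ^+ 2 / 4).
have b0 : 0 < n - t ^+ 2 / 4 by rewrite subr_gt0 ltr_pdivrMr// mulrC.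
have bne : b != 0 by rewrite gt_eqF// sqrtr_gt0.
have b2 : b ^+ 2 = n - t ^+ 2 / 4 by rewrite sqr_sqrtr// ltW.
pose K := b^-1 *: (x - areal (t / 2)).
have cx : aconj x = areal t - x by rewrite -tx /atrace addrAC subrr add0r.
have xx : x ** x = t *: x - areal n.
  by rewrite -nx /asqnorm cx amulBr amul_areal opprB addrC subrK.
have KK : K ** K = - aone.
  rewrite amulZl amulZr scalerA.
  have -> : (x - areal (t / 2)) ** (x - areal (t / 2)) = areal (- b ^+ 2).
    rewrite amulBr amul_areal amulDl amulNl areal_amul xx scalerBr.
    have -> : t *: x = (t / 2) *: x + (t / 2) *: x.
      by rewrite -scalerDl; congr (_ *: _); lra.
    rewrite [_ + _ - areal n - _]addrAC addrK opprB.
    rewrite addrC addrA addrAC addrK addrC b2.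
    by rewrite /areal scalerA -scalerBl; congr (_ *: _); field.
  by rewrite /areal scalerA mulrN -expr2 exprVn mulVf ?scaleN1r// sqrf_eq0.
have cK : aconj K = - K.
  rewrite aconjZ aconjD cx -[- areal _]scaleN1r !aconjZ aconj1 scaleN1r.
  rewrite /K -[RHS]scalerN opprB; congr (_ *: _); rewrite addrAC; congr (_ - _).
  by rewrite /areal -scalerBl; congr (_ *: _); lra.
have hK : imag_units A K.
  split=> //; right; exists 0, 1; rewrite /atrace /asqnorm cK subrr amulNr KK opprK.
  by rewrite /areal scale0r scale1r expr0n/= mulr1.
exists K, (t / 2 +i* b)%C; split=> //.
by rewrite /plane_point /slice_point /= scalerA mulfV// scale1r addrC subrK.
Qed.

(** * Spherical series *)

Section SphericalStems.
Context {R : realType} {A : altStarAlgType R}.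
Implicit Types (x y s J : A) (c d : R[i]) (z : R * R) (u : A * A) (t q : R).

Lemma Delta_plane_point y t q J c : imag_units A J ->
  atrace y = areal t -> asqnorm y = areal q ->
  Delta y (plane_point J c) = plane_point J (quad t q c).
Proof.
move=> hJ yt yq; rewrite /Delta yt yq -(plane_point_real J t) -(plane_point_real J q).
rewrite !plane_pointM// -plane_pointN -!plane_pointD; congr plane_point.
by rewrite /quad; ring.
Qed.

Lemma quad_plane_point_root c : quad (2 * re c) (re c ^+ 2 + im c ^+ 2) c = 0.
Proof.
case: c => a b; apply/eqP; rewrite eq_complex /quad expr2 !reimE /=.
by apply/andP; split; apply/eqP; ring.
Qed.

Lemma quad_conj t q c : quad t q c^*%C = (quad t q c)^*%C.
Proof.
case: c => a b; apply/eqP; rewrite eq_complex /quad !expr2 /=.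
by apply/andP; split; apply/eqP; ring.
Qed.

Lemma zvec_conj c s : zvec c^*%C s = ((zvec c s).1, - (zvec c s).2).
Proof. by case: c => a b; rewrite /zvec /= scaleNr. Qed.

Lemma ctensE z : ctens z = zvec (cplx z) (aone : A).
Proof. by []. Qed.

Lemma atens_areal (a : R) : atens (areal a) = zvec a%:C%C (aone : A).
Proof. by rewrite /atens /zvec /= scale0r. Qed.

Lemma cmul_zvec c u : cmul (zvec c aone) u = zscale c u.
Proof. by rewrite /cmul /zvec /= -!/(areal _) !areal_amul. Qed.

Lemma cpow_zvec c n : cpow (zvec c (aone : A)) n = zvec (c ^+ n) aone.
Proof.
elim: n => [|n IH]; first by rewrite expr0 /= -(atens_areal 1) /areal scale1r.
by rewrite /cpow iterS -/(cpow _ n) IH cmul_zvec zscaleM exprS.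
Qed.

Lemma cmul_atens u s : cmul u (atens s) = (u.1 ** s, u.2 ** s).
Proof. by rewrite /cmul /= !amul0 subr0 add0r. Qed.

Lemma cmul_zvec_atens c s : cmul (zvec c aone) (atens s) = zvec c s.
Proof. by rewrite cmul_atens /= -!/(areal _) !areal_amul. Qed.

Section FixedCentre.
Context (y : A) (t q : R) (yt : atrace y = areal t) (yq : asqnorm y = areal q).

Lemma DeltacE z : Deltac y z = zvec (quad t q (cplx z)) aone.
Proof.
rewrite /Deltac yt yq !ctensE !atens_areal !cmul_zvec !zscaleM -zvecN -!zvecD.
by congr zvec; rewrite /quad; ring.
Qed.

Lemma spherical_stem_even k z s :
  cmul (spherical_stem y k.*2 z) (atens s) = zvec (quad t q (cplx z) ^+ k) s.
Proof. by rewrite /spherical_stem odd_double doubleK DeltacE cpow_zvec cmul_zvec_atens. Qed.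

Lemma spherical_stem_odd k z s :
  cmul (spherical_stem y k.*2.+1 z) (atens s) =
  zvec (cplx z * quad t q (cplx z) ^+ k) s - zvec (quad t q (cplx z) ^+ k) (y ** s).
Proof.
rewrite /spherical_stem /= odd_double/= uphalf_double DeltacE cpow_zvec cmul_zvec.
have -> : - atens y = atens (- y) by rewrite /atens -[in RHS](@oppr0 A).
have zatens c v : zscale c (atens v) = zvec c v.
  by rewrite /zscale /= !scaler0 subr0 add0r.
rewrite zscaleD ctensE zscaleM zatens cmul_atens /= !amulDl !amulZl !amul1a !amulNl.
by rewrite -zvecNr [cplx z * _]mulrC.
Qed.

Lemma stem_spherical n s : stem setT (fun z => cmul (spherical_stem y n z) (atens s)).
Proof.
have qJ z : quad t q (cplx (cconj z)) = (quad t q (cplx z))^*%C by rewrite -quad_conj.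
have JX c k : c^*%C ^+ k = (c ^+ k)^*%C by rewrite rmorphXn.
move=> z _; rewrite -(odd_double_half n); case: (odd n); rewrite ?add1n ?add0n.
  rewrite !spherical_stem_odd qJ JX -[cplx (cconj z)]/((cplx z)^*%C) -rmorphM !zvec_conj /=.
  by rewrite opprD.
by rewrite !spherical_stem_even qJ JX zvec_conj.
Qed.

Definition stem_value J u : A := u.1 + J ** u.2.

Lemma stem_valueD J u u' : stem_value J (u + u') = stem_value J u + stem_value J u'.
Proof. by rewrite /stem_value amulDr addrACA. Qed.

Lemma stem_value_zvec J c s : stem_value J (zvec c s) = plane_point J c ** s.
Proof. by rewrite plane_point_amul /stem_value amulZr. Qed.

Definition spherical_coeffs (s : nat -> A) : (nat -> A) * (nat -> A) :=
  (fun k => s k.*2 - y ** s k.*2.+1, fun k => s k.*2.+1).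

(** The terms 2k and 2k+1 of the spherical series combine into one term of the series in powers of
    Delta, whence the 2N terms against N. *)
Lemma spherical_partial_sum (s : nat -> A) J c N : imag_units A J ->
  \sum_(0 <= n < N.*2) spherical_term y n (s n) (plane_point J c) =
  stem_value J (series (quad_term t q (spherical_coeffs s) c) N).
Proof.
move=> hJ; have termE n : spherical_term y n (s n) (plane_point J c) =
    stem_value J (cmul (spherical_stem y n (re c, im c)) (atens (s n))).
  by rewrite /spherical_term /plane_point (sliceE (stem_spherical n (s n))).
elim: N => [|N IH].
  by rewrite /series /= !big_geq// /stem_value amul0 addr0.
rewrite doubleS !big_nat_recr//= IH seriesSr stem_valueD -addrA; congr +%R.
rewrite !termE -stem_valueD spherical_stem_even spherical_stem_odd; congr stem_value.
have -> : cplx (re c, im c) = c by case: (c).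
by rewrite /quad_term /= zvecDr zvecNr -addrA; congr +%R; rewrite addrC.
Qed.

End FixedCentre.
End SphericalStems.

(** * From the radius of convergence to geometric bounds *)

Section RadiusOfConvergence.
Context {R : realType} {A : altStarAlgType R}.
Implicit Types (s : nat -> A) (r : \bar R) (sigma rho : R).

Lemma uradius_bound s sigma : 0 < sigma -> (sigma%:E < uradius s)%E ->
  exists M : R, forall n, `|s n| * sigma ^+ n <= M.
Proof.
move=> s0; rewrite /uradius; set l := limn_esup _ => sl.
have lt_l : (l < (sigma^-1)%:E)%E.
  case: l sl => [l| |] sl; last 2 first.
  - by move: sl; rewrite invey lte_fin ltNge ltW.
  - by rewrite ltNyr.
  rewrite lte_fin; have [l0|l0] := ltP 0 l; last by rewrite (le_lt_trans l0)// invr_gt0.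
  move: sl; rewrite inver gt_eqF// lte_fin => sl.
  by rewrite -[l]invrK ltf_pV2// posrE ?invr_gt0.
have [_ [B [N _ NB] <-] Bl] := ereal_inf_lt lt_l.
(* Indices start at 1 because the exponent 1/n is 0 for n = 0, where the root does not determine the
   norm. *)
have tail n : (N <= n)%N -> `|s n.+1| * sigma ^+ n.+1 <= 1.
  move=> Nn; have Bn : B n.+1 by apply: NB; rewrite /= ltnW.
  have : (((`|s n.+1|) `^ (n.+1%:R^-1))%:E < (sigma^-1)%:E)%E.
    by apply: le_lt_trans Bl; apply: ereal_sup_ubound; exists n.+1.
  rewrite lte_fin => /ltW h; rewrite -ler_pdivlMr ?exprn_gt0// mul1r -exprVn.
  have -> : `|s n.+1| = (`|s n.+1| `^ n.+1%:R^-1) ^+ n.+1.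
    by rewrite -powR_mulrn ?powR_ge0// -powRrM mulVf ?pnatr_eq0// powRr1.
  by rewrite lerXn2r// nnegrE ?powR_ge0// invr_ge0 ltW.
exists (1 + \sum_(n < N.+1) `|s n| * sigma ^+ n) => n.
have t0 i : 0 <= `|s i| * sigma ^+ i by rewrite mulr_ge0// exprn_ge0// ltW.
have [nN|] := ltnP n N.+1.
  rewrite (bigD1 (Ordinal nN))//= addrCA lerDl addr_ge0// sumr_ge0//.
case: n => [//|n] Nn; rewrite (le_trans (tail n Nn))// lerDl sumr_ge0//.
Qed.

(** Here [rho] measures the modulus of Delta, which is quadratic, while [r] is a radius for the s_n;
    hence the square root. *)
Definition inside_radius r rho := 0 <= rho /\ ((Num.sqrt rho)%:E < r)%E.

Lemma inside_radius_open r rho : inside_radius r rho ->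
  exists2 rho' : R, rho < rho' & inside_radius r rho'.
Proof.
move=> [rho0]; case: r => [r|_|//]; last first.
  by exists (rho + 1); [rewrite ltrDl|split; rewrite ?addr_ge0// ltry].
rewrite lte_fin => rr; have s0 : 0 <= Num.sqrt rho by rewrite sqrtr_ge0.
have [sigma /andP[s1 s2]] : exists x, Num.sqrt rho < x < r.
  by exists ((Num.sqrt rho + r) / 2); apply/andP; split; lra.
have sigma0 := le_lt_trans s0 s1.
exists (sigma ^+ 2); first by rewrite -(sqr_sqrtr rho0) ltrXn2r// nnegrE ltW.
by split; rewrite ?sqr_ge0// sqrtr_sqr gtr0_norm// lte_fin.
Qed.

(** With sigma the square root of rho', sigma^(2k) = rho'^k, and odd indices cost a division by
    sigma. A larger [rho'] makes sigma positive even when [rho] is 0. *)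
Lemma uradius_geom_bounded s y rho :
  (exists2 C : R, 0 <= C & forall x, `|y ** x| <= C * `|x|) ->
  inside_radius (uradius s) rho -> quad_bounded (spherical_coeffs y s) rho.
Proof.
move=> [C C0 yC] hr; have [r0 _] := hr; have [rho' rr' [r'0 r'r]] := inside_radius_open _ _ hr.
have r'p := le_lt_trans r0 rr'.
have s0 : 0 < Num.sqrt rho' by rewrite sqrtr_gt0.
have [M sM] := uradius_bound _ _ s0 r'r.
have sqX k : rho' ^+ k = Num.sqrt rho' ^+ k.*2.
  by rewrite -mul2n exprM sqr_sqrtr.
have h0 : geom_bounded (fun k => s k.*2) rho' by exists M => k; rewrite sqX.
have h1 : geom_bounded (fun k => s k.*2.+1) rho'.
  exists (M / Num.sqrt rho') => k; rewrite ler_pdivlMr// -mulrA sqX -exprSr.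
  exact: sM.
have h2 : geom_bounded (fun k => - (y ** s k.*2.+1)) rho'.
  apply: geom_bounded_le (ltW r'p) _ (geom_boundedZ C _ _ h1) => k.
  by rewrite normrN normrZ ger0_norm.
split; apply: (geom_bounded_mono _ _ rho' r0 (ltW rr')) => //.
exact: geom_boundedD.
Qed.

End RadiusOfConvergence.

(** * The change of variable at a root of Delta *)

Section DerivativesAtTheCentre.
Context {R : realType} {A : altStarAlgType R}.
Context (J : A) (hJ : imag_units A J) (t q : R) (c : R[i]) (c0 : quad t q c = 0).
Implicit Types (ab : (nat -> A) * (nat -> A)).

Let w := 2 * c - t%:C%C.
Local Notation act d x := (plane_point J d ** x).

(* Coordinates in which [quad_deriv] becomes [sph_deriv]: the series
   sum_k Delta^k (a_k + z b_k) is rewritten as a series in Delta^k and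
   Delta^k (z - c), whose l-th coefficient is then multiplied by w ^ (m + l). *)
Definition centred_coeffs m ab l : A :=
  act (w ^+ (m + l))
    (if odd l then ab.2 l./2 else ab.1 l./2 + act c (ab.2 l./2)).

Lemma act_addl d d' (x : A) : act (d + d') x = act d x + act d' x.
Proof. by rewrite plane_pointD amulDl. Qed.

Lemma act_scaler d (a : R) (x : A) : act d (a *: x) = act (d * a%:C%C) x.
Proof. by rewrite amulZr !plane_point_amul reM imM /= !mulr0 subr0 add0r scalerDr !scalerA
  ![_ * a]mulrC. Qed.

Lemma act_natmul d n (x : A) : act d x *+ n = act (d * n%:R) x.
Proof. by rewrite -realc_nat -act_scaler amulZr scaler_nat. Qed.

Lemma act_opp d (x : A) : - act d x = act (- d) x.
Proof. by rewrite plane_pointN amulNl. Qed.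

(** The exponent of w grows with m because d/dh = w d/dz. Since c is a root, q = t c - c^2, and the
    identity becomes one between polynomials in c and t acting through J. *)
Lemma centred_coeffs_deriv m ab :
  centred_coeffs m.+1 (quad_deriv t q ab) = sph_deriv (centred_coeffs m ab).
Proof.
have qE : q%:C%C = t%:C%C * c - c ^+ 2.
  by apply/eqP; rewrite -subr_eq0 -[X in _ == X]c0 /quad; apply/eqP; ring.
apply/funext => l; rewrite -(odd_double_half l); move: l./2 => k.
case: (odd l); rewrite ?add1n ?add0n /sph_deriv /centred_coeffs /= ?odd_double /=
    ?uphalf_double ?doubleK.
  rewrite addSn !addnS !exprSr; set W := w ^+ (m + k.*2).
  rewrite !(amulDr, act_scaler, plane_point_amulA J hJ) mulrnBl !mulrnDl !act_natmul.
  rewrite act_opp addrACA -!act_addl -addrA -act_addl !realc_nat.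
  by congr (act _ _ + act _ _); rewrite /w; ring.
rewrite addSn !addnS !exprSr; set W := w ^+ (m + k.*2).
rewrite !(amulDr, amulNr, act_opp, act_scaler, plane_point_amulA J hJ) !mulrnDl !act_natmul.
rewrite addrAC addrACA -!act_addl !realcM !realcN !realc_nat qE.
by congr (act _ _ + act _ _ + act _ _); rewrite /w; ring.
Qed.

Lemma iter_centred_coeffs m ab :
  centred_coeffs m (iter m (quad_deriv t q) ab) = iter m sph_deriv (centred_coeffs 0 ab).
Proof. by elim: m => [//|m IH]; rewrite !iterS -IH centred_coeffs_deriv. Qed.

End DerivativesAtTheCentre.

(** * Slice derivatives of the sum at the roots of Delta *)

Section SphericalSum.
Context {R : realType} {A : altStarAlgType R}.
Context (hS : imag_units A !=set0) (hN : cone_norm A).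
Context (y : A) (t q : R) (yt : atrace y = areal t) (yq : asqnorm y = areal q).
Implicit Types (r : \bar R) (ab : (nat -> A) * (nat -> A)) (c : R[i]).

Lemma amul_linear (x : A) : linear (amul x).
Proof. by move=> k u v; rewrite amulPr. Qed.

Lemma amul_cvg (x : A) (f : nat -> A) (l : A) :
  f @ \oo --> l -> (fun n => x ** f n) @ \oo --> x ** l.
Proof.
have [C C0 xC] := findim_linear_bounded (@afindim R A) A (amul x) (amul_linear x).
move=> fl; apply/cvgrPdist_le => e e0; near=> n.
rewrite -amulBr (le_trans (xC _))//.
rewrite (le_trans _ (_ : (C + 1) * (e / (C + 1)) <= _))//; last first.
  by rewrite mulrC divfK// gt_eqF// ltr_wpDl.
rewrite ler_pM// ?lerDl//; near: n; apply: (cvgrPdist_le _ _).1 fl _ _.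
by rewrite divr_gt0// ltr_wpDl.
Unshelve. all: by end_near. Qed.

Lemma normed_cvg_alg (u : nat -> A) : cvgn [normed series u] -> cvgn (series u).
Proof. exact: (findim_normed_cvg (@afindim R A)). Qed.

Definition quad_domain r : set (R * R) :=
  [set z | inside_radius r (cabs (quad t q (cplx z)))].

Lemma cplxK c : cplx (re c, im c) = c.
Proof. by case: c. Qed.

Lemma Uball_circular r : Uball y r = circular (quad_domain r).
Proof.
have cE J c : imag_units A J -> `|Delta y (plane_point J c)| = cabs (quad t q c).
  by move=> hJ; rewrite (Delta_plane_point y t q)// norm_plane_point.
apply/seteqP; split => x.
  move=> [/(quadratic_coneP _ _ _ hS)[J [c [hJ ->]]]]; rewrite cE// => cr.
  exists (re c, im c), J; split=> //; split; rewrite ?cabs_ge0//.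
  by rewrite cplxK.
move=> [z [J [[_ zr] hJ ->]]]; rewrite slice_pointE; split.
  exact: plane_point_cone.
by rewrite cE.
Qed.

Lemma cplx_conj (z : R * R) : cplx (cconj z) = (cplx z)^*%C.
Proof. by []. Qed.

Lemma cabs_conj c : cabs c^*%C = cabs c.
Proof. by case: c => a b; rewrite !cabsE /= sqrrN. Qed.

Lemma quad_domain_conj r z : quad_domain r z -> quad_domain r (cconj z).
Proof. by rewrite /quad_domain /mkset cplx_conj quad_conj cabs_conj. Qed.

(** The expression is the squared modulus of Delta at u + i v in real coordinates; its continuity
    makes the domain open. *)
Lemma quad_modulus_cvg (T : Type) (F : set_system T) (FF : Filter F) (u v : T -> R)
    (a b : R) : u @ F --> a -> v @ F --> b ->
  ((u x * u x - v x * v x - t * u x + q) * (u x * u x - v x * v x - t * u x + q)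
   + (u x * v x + u x * v x - t * v x) * (u x * v x + u x * v x - t * v x)) @[x --> F] -->
  (a * a - b * b - t * a + q) * (a * a - b * b - t * a + q)
   + (a * b + a * b - t * b) * (a * b + a * b - t * b).
Proof.
move=> ua vb.
have ct : (fun=> t) @ F --> t by exact: cvg_cst.
have cq : (fun=> q) @ F --> q by exact: cvg_cst.
have p1 : (fun x => u x * u x - v x * v x - t * u x + q) @ F --> a * a - b * b - t * a + q.
  by apply: (cvgD _ cq); apply: cvgB; [apply: cvgB|]; exact: cvgM.
have p2 : (fun x => u x * v x + u x * v x - t * v x) @ F --> a * b + a * b - t * b.
  by apply: cvgB; [apply: cvgD|]; exact: cvgM.
by apply: cvgD; exact: cvgM.
Qed.

Lemma quad_domain_open r : open (quad_domain r).
Proof.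
pose f (z : R * R) := Num.sqrt (cabs (quad t q (cplx z))).
pose p (z : R * R) : R := (z.1 * z.1 - z.2 * z.2 - t * z.1 + q)
  * (z.1 * z.1 - z.2 * z.2 - t * z.1 + q)
  + (z.1 * z.2 + z.1 * z.2 - t * z.2) * (z.1 * z.2 + z.1 * z.2 - t * z.2).
have cp : continuous p.
  by move=> [a b]; apply: quad_modulus_cvg; [exact: cvg_fst|exact: cvg_snd].
have fE : f = Num.sqrt \o (Num.sqrt \o p).
  have pE z : p z = re (quad t q (cplx z)) ^+ 2 + im (quad t q (cplx z)) ^+ 2.
    by rewrite /p /quad expr2 !reimE /=; ring.
  by apply/funext => z; rewrite /f cabsE -pE.
have cf : continuous f.
  rewrite fE => z; apply: continuous_comp; last exact: sqrt_continuous.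
  by apply: continuous_comp; [exact: cp | exact: sqrt_continuous].
have -> : quad_domain r = f @^-1` [set x | (x%:E < r)%E].
  apply/seteqP; split => z; first by case.
  by split => //; exact: cabs_ge0.
apply: open_comp => [z _|]; first exact: cf.
case: r => [r| |].
- have -> : [set x : R | (x%:E < r%:E)%E] = [set x | x < r].
    by apply/seteqP; split => x /=; rewrite lte_fin.
  exact: open_lt.
- have -> : [set x : R | (x%:E < +oo)%E] = setT; last exact: openT.
  by apply/seteqP; split => x //= _; rewrite ltry.
- have -> : [set x : R | (x%:E < -oo)%E] = set0; last exact: open0.
  by apply/seteqP; split.
Qed.

Lemma quad_domain_slice r c : (0 < r)%E -> quad t q c = 0 -> slice_domain (quad_domain r).
Proof.
move=> r0 c0; split; [|exact: quad_domain_open|exact: quad_domain_conj].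
exists (re c, im c); rewrite /quad_domain /mkset cplxK.
by rewrite c0 ComplexField.Normc.normc0; split; rewrite ?sqrtr0.
Qed.

Definition bounded_inside r ab := forall rho, inside_radius r rho -> quad_bounded ab rho.

Lemma bounded_inside_deriv r ab :
  bounded_inside r ab -> bounded_inside r (quad_deriv t q ab).
Proof.
move=> abB rho rhor; have [rho' rr' r'r] := inside_radius_open _ _ rhor.
exact: quad_bounded_deriv rhor.1 rr' (abB _ r'r).
Qed.

Lemma bounded_inside_iter r ab m :
  bounded_inside r ab -> bounded_inside r (iter m (quad_deriv t q) ab).
Proof. by move=> abB; elim: m => [//|m IH]; rewrite iterS; exact: bounded_inside_deriv. Qed.

Lemma quad_stem_cvg r ab z : bounded_inside r ab -> quad_domain r z ->
  series (quad_term t q ab (cplx z)) @ \oo --> quad_stem t q ab z.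
Proof.
move=> abB zr; have [rho zrho rhor] := inside_radius_open _ _ zr.
exact: (quad_series_cvg normed_cvg_alg _ _ _ _ _ zrho (abB _ rhor)).
Qed.

Lemma quad_stem_stem r ab : bounded_inside r ab -> stem (quad_domain r) (quad_stem t q ab).
Proof.
move=> abB z zr; have [c1 c2] := cvg_fst_snd _ _ (quad_stem_cvg _ _ _ abB zr).
have [d1 d2] := cvg_fst_snd _ _ (quad_stem_cvg _ _ _ abB (quad_domain_conj _ _ zr)).
have sE N : series (quad_term t q ab (cplx (cconj z))) N =
  ((series (quad_term t q ab (cplx z)) N).1, - (series (quad_term t q ab (cplx z)) N).2).
  elim: N => [|N IH]; first by rewrite /series /= !big_geq//= oppr0.
  rewrite !seriesSr IH cplx_conj /quad_term quad_conj.
  rewrite -rmorphXn -rmorphM !zvec_conj /= !opprD.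
  by [].
have e1 : (fun n => (series (quad_term t q ab (cplx (cconj z))) n).1) =
          (fun n => (series (quad_term t q ab (cplx z)) n).1).
  by apply/funext => n; rewrite sE.
have e2 : (fun n => (series (quad_term t q ab (cplx (cconj z))) n).2) =
          (fun n => - (series (quad_term t q ab (cplx z)) n).2).
  by apply/funext => n; rewrite sE.
rewrite e1 in d1; rewrite e2 in d2.
split; first by apply: (cvg_unique _ d1 c1); exact: norm_hausdorff.
by apply: (cvg_unique _ d2 (cvgN c2)); exact: norm_hausdorff.
Qed.

Lemma iter_dz_quad_stem r ab m : bounded_inside r ab ->
  {in quad_domain r, iter m dz (quad_stem t q ab) =1
                     quad_stem t q (iter m (quad_deriv t q) ab)}.
Proof.
move=> abB; elim: m => [//|m IH] z zr; rewrite !iterS.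
transitivity (dz (quad_stem t q (iter m (quad_deriv t q) ab)) z).
  exact: (eq_iter_dz 1 (quad_domain_open r) IH zr).
move/set_mem: zr => zr; have [rho zrho rhor] := inside_radius_open _ _ zr.
have [rho' rr' r'r] := inside_radius_open _ _ rhor.
apply: (dz_quad_stem normed_cvg_alg _ _ _ _ _ _ zrho rr').
exact: (bounded_inside_iter _ _ m abB).
Qed.

Lemma quad_stem_root r ab z : bounded_inside r ab -> quad_domain r z ->
  quad t q (cplx z) = 0 ->
  quad_stem t q ab z = zvec 1 (ab.1 0) + zvec (cplx z) (ab.2 0).
Proof.
move=> abB zr z0; have := quad_stem_cvg _ _ _ abB zr.
move/(cvg_comp _ _ (cvg_addnl 1)) => cS; apply: (pair_cvg_unique _ _ _ cS).
rewrite (_ : _ \o _ = fun=> zvec 1 (ab.1 0) + zvec (cplx z) (ab.2 0)); first exact: cvg_cst.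
apply/funext => N /=; elim: N => [|N IH]; rewrite /= add1n seriesSr.
  by rewrite /series /= big_geq// add0r /quad_term expr0 mulr1.
rewrite -add1n IH /quad_term z0 expr0n/= mulr0.
by rewrite /zvec /= !scale0r addr0 addr0.
Qed.

Lemma stem_value_cvg J (f : nat -> A * A) (u : A * A) : f @ \oo --> u ->
  (fun n => stem_value J (f n)) @ \oo --> stem_value J u.
Proof. by move=> /cvg_fst_snd[f1 f2]; apply: cvgD => //; exact: amul_cvg. Qed.

(** Along even numbers of terms the spherical partial sums converge both to S and to the value
    induced by [quad_stem]. This gives the explicit stem function from which the slice derivatives
    are computed. *)
Lemma slice_repr_spherical_sum s r S c : quad t q c = 0 -> (0 < r)%E ->
  bounded_inside r (spherical_coeffs y s) ->
  (forall x, Uball y r x ->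
    (fun N => \sum_(0 <= n < N) spherical_term y n (s n) x) @ \oo --> S x) ->
  slice_repr (Uball y r) S (quad_domain r) (quad_stem t q (spherical_coeffs y s)).
Proof.
move=> c0 r0 sB sS; have sstem := quad_stem_stem _ _ sB.
split => //; first exact: quad_domain_slice c0.
  exact: Uball_circular.
move=> x Ux; have := Ux; rewrite Uball_circular => -[z [J [zr hJ xE]]].
rewrite xE (sliceE sstem zr hJ) -xE.
have dbl : (fun N => N.*2) @ \oo --> \oo.
  apply/cvgnyPge => N; near=> k; rewrite -addnn (leq_trans _ (leq_addr _ _))//.
  by near: k; exact: nbhs_infty_ge.
have := cvg_comp _ _ dbl (sS x Ux).
rewrite (_ : _ \o _ = fun N => stem_value J
  (series (quad_term t q (spherical_coeffs y s) (cplx z)) N)); last first.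
  by apply/funext => N /=; rewrite xE slice_pointE (spherical_partial_sum y t q).
move=> cS; apply: (cvg_unique _ cS (stem_value_cvg J _ _ (quad_stem_cvg _ _ _ sB zr))).
exact: norm_hausdorff.
Unshelve. all: by end_near. Qed.

Lemma slice_deriv_root s r S m J c : imag_units A J -> quad t q c = 0 -> (0 < r)%E ->
  bounded_inside r (spherical_coeffs y s) ->
  (forall x, Uball y r x ->
    (fun N => \sum_(0 <= n < N) spherical_term y n (s n) x) @ \oo --> S x) ->
  forall ab, ab = iter m (quad_deriv t q) (spherical_coeffs y s) ->
  slice_deriv (Uball y r) S m (plane_point J c) =
  ab.1 0 + plane_point J c ** ab.2 0.
Proof.
move=> hJ c0 r0 sB sS ab abE.
have abB : bounded_inside r ab by rewrite abE; exact: bounded_inside_iter.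
rewrite (slice_derivE _ _ hS (slice_repr_spherical_sum _ _ _ _ c0 r0 sB sS)).
have cr : quad_domain r (re c, im c).
  by rewrite /quad_domain /mkset cplxK c0 ComplexField.Normc.normc0; split; rewrite ?sqrtr0.
have E z : quad_domain r z -> iter m dz (quad_stem t q (spherical_coeffs y s)) z =
    quad_stem t q ab z.
  by move=> zr; rewrite abE; exact: (iter_dz_quad_stem _ _ m sB z (mem_set zr)).
move: (iter m dz _) E => F E.
have st : stem (quad_domain r) F.
  move=> z zr; rewrite (E _ zr) (E _ (quad_domain_conj _ _ zr)).
  exact: (quad_stem_stem _ _ abB).
rewrite /plane_point (sliceE st cr hJ) (E _ cr) (quad_stem_root _ _ _ abB cr) ?cplxK//.
rewrite -/(stem_value _ _) stem_valueD !stem_value_zvec.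
by rewrite (plane_point_real J 1) areal_amul scale1r.
Qed.

End SphericalSum.

(** * The linear system satisfied by the coefficients *)

Section SphericalSystem.
Context {R : realType} {A : altStarAlgType R}.
Context (hS : imag_units A !=set0) (hN : cone_norm A).
Context (J : A) (hJ : imag_units A J) (c : R[i]).

Let y := plane_point J c.
Let t : R := 2 * re c.
Let q : R := re c ^+ 2 + im c ^+ 2.
Let w := 2 * c - t%:C%C.

Lemma double_aIm : 2 *: aIm y = plane_point J w.
Proof.
rewrite /aIm scalerA mulfV ?pnatr_eq0// scale1r aconj_plane_point//.
rewrite -plane_pointN -plane_pointD.
congr plane_point; rewrite /w /t; case: c => a b.
by apply/eqP; rewrite eq_complex !reimE /=; apply/andP; split; apply/eqP; ring.
Qed.

Lemma plane_point_conjE : c^*%C = c - w.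
Proof.
rewrite /w /t; case: c => a b.
by apply/eqP; rewrite eq_complex !reimE /=; apply/andP; split; apply/eqP; ring.
Qed.

Lemma plane_point_sign n (x : A) : plane_point J ((-1) ^+ n) ** x = (-1) ^+ odd n *: x.
Proof.
have J1 : plane_point J 1 ** x = x by rewrite (plane_point_real J 1) areal_amul scale1r.
rewrite -signr_odd; case: (odd n); rewrite ?expr1 ?expr0 ?scale1r ?scaleN1r//.
by rewrite plane_pointN amulNl J1.
Qed.

Lemma centred_coeffs_spherical (s : nat -> A) l :
  centred_coeffs J t c 0 (spherical_coeffs y s) l = apow (2 *: aIm y) l ** s l.
Proof.
rewrite double_aIm apow_plane_point// /centred_coeffs add0n -/w.
congr (_ ** _); have := odd_double_half l.
by case: (odd l) => /=; rewrite ?add1n ?add0n => lE; rewrite ?subrK lE.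
Qed.

Lemma spherical_system (s : nat -> A) (r : \bar R) (S : A -> A) :
  spherical_sum y s r S ->
  lower_mul spherical_matrix (fun n => apow (2 *: aIm y) n ** s n) =
  spherical_data y (Uball y r) S.
Proof.
move=> [r0 rE _ sS].
have yt : atrace y = areal t by exact: atrace_plane_point.
have yq : asqnorm y = areal q by exact: asqnorm_plane_point.
have c0 : quad t q c = 0 by exact: quad_plane_point_root.
have c0' : quad t q c^*%C = 0 by rewrite quad_conj c0; exact: conjc0.
have sB : bounded_inside r (spherical_coeffs y s).
  move=> rho rhor; apply: uradius_geom_bounded; last by rewrite rE.
  exact: (findim_linear_bounded (@afindim R A) A (amul y) (amul_linear y)).
have dS m d : quad t q d = 0 -> slice_deriv (Uball y r) S m (plane_point J d) = _ :=
  fun d0 => slice_deriv_root hS hN y t q yt yq s r S m J d hJ d0 r0 sB sS _ erefl.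
have -> : (fun n => apow (2 *: aIm y) n ** s n) =
    centred_coeffs J t c 0 (spherical_coeffs y s).
  by apply/funext => l; rewrite centred_coeffs_spherical.
have factK m (x : A) : (m`!%:R : R)^-1 *: (x *+ m`!) = x.
  by rewrite -(scaler_nat _ x) scalerK// pnatr_eq0 -lt0n fact_gt0.
have iterE m := iter_centred_coeffs J hJ t q c c0 m (spherical_coeffs y s).
set u := centred_coeffs J t c 0 _ in iterE *.
have even_case m : lower_mul spherical_matrix u m.*2 = spherical_data y (Uball y r) S m.*2.
  rewrite /lower_mul /spherical_data odd_double doubleK /= dS// double_aIm.
  rewrite apow_plane_point//.
  have := iter_sph_deriv_even u m m.+1 (ltnSn _).
  rewrite -iterE {1}/centred_coeffs /= addn0 -/w => ->.
  rewrite factK doubleS [RHS]big_ord_recr/=.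
  by rewrite spherical_matrix_lower// mulr0z addr0.
have odd_case m :
    lower_mul spherical_matrix u m.*2.+1 = spherical_data y (Uball y r) S m.*2.+1.
  rewrite /lower_mul /spherical_data /= odd_double /= uphalf_double aconj_plane_point// dS//.
  rewrite double_aIm -plane_pointN apow_plane_point// -doubleS.
  have := iter_sph_deriv_odd u m m.+1 (ltnSn _).
  rewrite -iterE {1 2}/centred_coeffs /= addn0 addn1 -/w.
  set a := (iter _ _ _).1 0; set b := (iter _ _ _).2 0; set L := \sum_(l < _) _.
  (* The conjugate of c is c - w, so the difference of the two first centred coefficients is w^m
     times the value at the conjugate, as expected at h = -1. *)
  have -> : plane_point J (w ^+ m) ** (a + plane_point J c ** b)
      - plane_point J (w ^+ m.+1) ** b =
      plane_point J (w ^+ m) ** (a + plane_point J c^*%C ** b).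
    rewrite plane_point_conjE plane_pointD amulDl plane_pointN amulNl !amulDr amulNr.
    by rewrite !plane_point_amulA// -exprSr addrA.
  (* The sign of (-w)^m cancels the one in [iter_sph_deriv_odd]. *)
  move=> h; rewrite exprNn -plane_point_amulA// {}h plane_point_sign.
  by rewrite -[in X in _ *~ X]signr_odd; case: (odd m);
    rewrite ?expr1 ?expr0 ?mulN1r ?mul1r ?mulrNz ?scaleN1r ?opprK ?scale1r -?pmulrn factK.
apply/funext => n; rewrite -(odd_double_half n).
by case: (odd n); rewrite ?add1n ?add0n.
Qed.

End SphericalSystem.

Lemma intmul_sign (R : pzRingType) (V : lmodType R) (x : V) k :
  x *~ (-1) ^+ k = (-1) ^+ k *: x.
Proof.
by rewrite -signr_odd -[in RHS]signr_odd; case: (odd k);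
  rewrite ?expr1 ?expr0 ?mulrN1z ?mulr1z ?scaleN1r ?scale1r.
Qed.

(* The sign (-1) ^+ 'C(n, 2), the leading principal minor of order n of the
   spherical matrix, comes from Cramer's rule.  It is missing in the source,
   where the formula fails already for n = 2: the determinant is then
   - (2 Im y)^2 s_2, so that (- 2 Im y)^(-2) det = - s_2. *)
Theorem theorem3p7 (R : realType) (A : altStarAlgType R)
    (hS : imag_units A !=set0) (hN : cone_norm A)
    (y : A) (hy : quadratic_cone A y) (hyR : ~ exists a : R, y = areal a)
    (s : nat -> A) (r : \bar R) (S : A -> A)
    (hsum : spherical_sum y s r S) :
  let w : A := 2 *: aIm y in
  let dS := slice_deriv (Uball y r) S in
  let E := spherical_data y (Uball y r) S in
  ((lower_mul spherical_matrix (fun n => apow w n ** s n) = E /\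
    (forall u : nat -> A, lower_mul spherical_matrix u = E ->
       u = (fun n => apow w n ** s n))) /\
   (forall n : nat,
      s n = (-1) ^+ 'C(n, 2) *:
        (ainv (apow (- w) n) **
         det_last (\matrix_(i < n.+1, j < n) spherical_matrix i j)
                  (fun i => E i))) /\
   (forall (s' : nat -> A) (r' : \bar R) (S' : A -> A),
      spherical_sum y s' r' S' ->
      (forall n : nat, slice_deriv (Uball y r') S' n y = dS n y) ->
      (forall n : nat,
         slice_deriv (Uball y r') S' n (aconj y) = dS n (aconj y)) ->
      s' = s)) /\
  (forall n : nat,
     (n`!%:R : R)^-1 *: dS n y =
       ainv (apow w n) **
       (\sum_(n <= l < (2 * n).+1)
          (apow w l ** s l) *~ spherical_matrix (2 * n) l)).
Proof.
move=> w dS E; have [J [c [hJ yE]]] := quadratic_coneP _ _ _ hS hy.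
have sysE s' r' S' : spherical_sum y s' r' S' ->
    lower_mul spherical_matrix (fun n => apow w n ** s' n) = spherical_data y (Uball y r') S'.
  by rewrite /w yE; exact: spherical_system.
(* This is 2 i Im(c), the complex number of w; it is nonzero exactly because y is not real. *)
pose om := 2 * c - (2 * re c)%:C%C.
have om0 : om != 0.
  apply: contra_notN hyR => /eqP om0; exists (re c); rewrite yE.
  have : im c^*%C = im c by rewrite plane_point_conjE -/om om0 subr0.
  have -> : im c^*%C = - im c by case: (c).
  move=> /eqP; rewrite eq_sym -addr_eq0 -mulr2n -mulr_natr mulf_eq0 pnatr_eq0 orbF => /eqP imc.
  by rewrite /plane_point /slice_point /= imc scale0r addr0.
have wE : w = plane_point J om by rewrite /w yE double_aIm.
have powK d n (x : A) : d != 0 ->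
    ainv (apow (plane_point J d) n) ** (apow (plane_point J d) n ** x) = x.
  move=> d0; have dn0 : d ^+ n != 0 by rewrite expf_neq0.
  by rewrite apow_plane_point// ainv_plane_point// plane_pointVK.
have sys := sysE _ _ _ hsum.
have sys_inj u : lower_mul spherical_matrix u = E -> u = fun n => apow w n ** s n.
  by move=> uE; apply: (lower_mul_inj _ _ _ spherical_matrix_diag); rewrite uE sys.
split; first split; [by split|split|].
- move=> n; rewrite /E -sys.
  rewrite (det_last_lower_mul spherical_matrix _ _ spherical_matrix_lower).
  rewrite (eq_bigr (fun i : 'I_n.+1 => (-1) ^+ i)); last first.
    by move=> i _; exact: spherical_matrix_diag.
  rewrite prod_signs intmul_sign amulZr scalerA.
  have -> : apow w n ** s n = (-1) ^+ odd n *: (apow (- w) n ** s n).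
    rewrite wE -plane_pointN !apow_plane_point//.
    have -> : om ^+ n = (-1) ^+ n * (- om) ^+ n by rewrite -exprNn opprK.
    by rewrite -plane_point_amulA// plane_point_sign.
  rewrite amulZr scalerA signr_odd exprD mulrA -expr2 sqrr_sign mul1r -expr2 sqrr_sign.
  by rewrite scale1r wE -plane_pointN powK// oppr_eq0.
(* Equal derivatives give equal right-hand sides E, hence equal solutions w^n s_n, and w^n is
   cancelled on the left. *)
- move=> s' r' S' hsum' dSy dSyc; have sys' := sysE _ _ _ hsum'.
  have E'E : spherical_data y (Uball y r') S' = E.
    by apply/funext => n; rewrite /E /spherical_data dSy dSyc.
  have := sys_inj _ (etrans sys' E'E) => h; apply/funext => n.
  have := congr1 (fun f => ainv (apow w n) ** f n) h.
  by rewrite /= wE !powK.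
move=> n; have := congr1 (fun f => f n.*2) sys.
rewrite /lower_mul /E /spherical_data odd_double doubleK /= -/w => En.
have -> : (n`!%:R : R)^-1 *: dS n y =
    ainv (apow w n) ** ((n`!%:R : R)^-1 *: (apow w n ** dS n y)).
  by rewrite amulZr wE powK.
rewrite -En -mul2n; congr (_ ** _).
rewrite -(big_mkord xpredT (fun l => (apow w l ** s l) *~ spherical_matrix (2 * n) l)).
rewrite (big_cat_nat (n := n))//=; last by rewrite mul2n -addnn leqW// leq_addl.
rewrite big1_seq ?add0r// => l /andP[_]; rewrite mem_index_iota => /= ln.
rewrite (_ : spherical_matrix _ _ = 0) ?mulr0z//.
rewrite /spherical_matrix mul2n odd_double doubleK /=.
(* For l < n the lower index of the binomial entry in row 2n exceeds the upper one, so the sum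
   starts at n. *)
have bin_small' k (b : int) : k%:Z < b -> binZ k b = 0.
  by case: b => // b; rewrite ltz_nat /= => kb; rewrite bin_small.
by case: ifP => lo; rewrite bin_small'//; lia.
Qed.
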